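(* QPTL and behavioral GFG-QPTL are equi-expressive: for every QPTL formula $\varphi$ there is a behavioral GFG-QPTL formula $\varphi'$ with $\mathrm{free}(\varphi')=\mathrm{free}(\varphi)$ such that for every assignment $\chi\in\mathrm{Asg}(\mathrm{free}(\varphi))$, $\chi\models\varphi$ (Tarski semantics) iff $\{\{\chi\}\}\models^{\exists\forall}\varphi'$; and conversely, for every behavioral GFG-QPTL formula $\varphi'$ there is a QPTL formula $\varphi$ with the same free propositions satisfying the same equivalence for all $\chi\in\mathrm{Asg}(\mathrm{free}(\varphi'))$.
   Context: Let $AP$ be a set of atomic propositions and $\mathbb B=\{\top,\bot\}$. A temporal valuation is a function $f:\mathbb N\to\mathbb B$. An assignment is a partial function $\chi:AP\rightharpoonup(\mathbb N\to\mathbb B)$; $\mathrm{Asg}$ is the set of all assignments, $\mathrm{Asg}(P)$ the set of assignments with domain exactly $P\subseteq AP$. For an assignment $\chi$, $p\in AP$ and a temporal valuation $f$, $\chi[p\mapsto f]$ is the assignment that agrees with $\chi$ except that it maps $p$ to $f$. QPTL formulas are generated by $\varphi::=\psi\mid\neg\varphi\mid\varphi\wedge\varphi\mid\varphi\vee\varphi\mid\exists p.\varphi\mid\forall p.\varphi$, where $\psi$ ranges over LTL formulas over $AP$ and $p\in AP$; $\mathrm{free}(\varphi)$ is the set of free propositions. Tarski semantics, for $\chi\in\mathrm{Asg}_\supseteq(\mathrm{free}(\varphi))$: $\chi\models\psi$ for LTL $\psi$ iff the infinite word whose $t$-th letter is the valuation $q\mapsto\chi(q)(t)$ satisfies $\psi$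 in the standard LTL sense (written $\chi\models_{LTL}\psi$); Boolean connectives as usual; $\chi\models\exists p.\phi$ iff $\chi[p\mapsto f]\models\phi$ for some temporal valuation $f$; $\chi\models\forall p.\phi$ iff for all $f$. A hyperassignment is a set $\mathcal X$ with $\emptyset\neq\mathcal X\subseteq 2^{\mathrm{Asg}(P)}$ and $\emptyset\notin\mathcal X$, for some $P\subseteq AP$; this $P$ is denoted $\mathrm{ap}(\mathcal X)$. A choice function for $\mathcal X$ is a map $c:\mathcal X\to\mathrm{Asg}$ with $c(X)\in X$; the dual of $\mathcal X$ is $\overline{\mathcal X}=\{\mathrm{img}(c): c\text{ a choice function for }\mathcal X\}$. A functor over $P$ is a function $F:\mathrm{Asg}(P)\to(\mathbb N\to\mathbb B)$; $\mathrm{ext}(X,F,p)=\{\chi[p\mapsto F(\chi)]:\chi\in X\}$. For $\chi_1,\chi_2\in\mathrm{Asg}(P)$, $p\in P$, $k\in\mathbb N$: $\chi_1\approx^{>k}_p\chi_2$ iff $\chi_1(q)=\chi_2(q)$ for all $q\in P\setminus\{p\}$ and $\chi_1(p)(t)=\chi_2(p)(t)$ for all $t\le k$. $F$ is behavioral w.r.t. $p$ if $F(\chi_1)(k)=F(\chi_2)(k)$ whenever $\chi_1\approx^{>k}_p\chi_2$. Let $\mathrm{Fnc}_{\mathsf B}(P)$ be the set of functors over $P$ behavioral w.r.t. every $p\in P$, and $\mathrm{ext}_{\mathsf B}(\mathcal X,p)=\{\mathrm{ext}(X,F,p):X\in\mathcal X,F\in\mathrm{Fnc}_{\mathsf B}(\mathrm{ap}(\mathcal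 X))\}$. A behavioral GFG-QPTL formula is $\varphi'=Q_1^{\mathsf B}p_1.\cdots Q_n^{\mathsf B}p_n.\psi$ with $Q_i\in\{\exists,\forall\}$, pairwise distinct $p_i\in AP$ and $\psi$ LTL; $\mathrm{free}(\varphi')$ are the propositions of $\psi$ other than the $p_i$. For a hyperassignment $\mathcal X$ with $\mathrm{ap}(\mathcal X)\supseteq\mathrm{free}(\varphi')$ and $p_i\notin\mathrm{ap}(\mathcal X)$, and flags $\exists\forall,\forall\exists$: (1) $\mathcal X\models^{\exists\forall}\psi$ iff some $X\in\mathcal X$ has all $\chi\in X$ with $\chi\models_{LTL}\psi$; $\mathcal X\models^{\forall\exists}\psi$ iff every $X\in\mathcal X$ has some $\chi\in X$ with $\chi\models_{LTL}\psi$; (2) $\mathcal X\models^{\exists\forall}\exists^{\mathsf B}p.\phi$ iff $\mathrm{ext}_{\mathsf B}(\mathcal X,p)\models^{\exists\forall}\phi$, and $\mathcal X\models^{\forall\exists}\exists^{\mathsf B}p.\phi$ iff $\overline{\mathcal X}\models^{\exists\forall}\exists^{\mathsf B}p.\phi$; (3) $\mathcal X\models^{\forall\exists}\forall^{\mathsf B}p.\phi$ iff $\mathrm{ext}_{\mathsf B}(\mathcal X,p)\models^{\forall\exists}\phi$, and $\mathcal X\models^{\exists\forall}\forall^{\mathsf B}p.\phi$ iff $\overline{\mathcal X}\models^{\forall\exists}\forall^{\mathsf B}p.\phi$. (For singleton hyperassignments $\{\{\chi\}\}$ the two flags give the same verdict.)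
   Formalization: The set AP of atomic propositions is taken to be countably infinite (the natural numbers); for a finite AP with at least two propositions the claim fails for lack of fresh propositions, and any infinite AP reduces to the countable case by renaming. *)

(* Defs.v *)
From Stdlib Require Import List Arith.
Import ListNotations.

Definition AP := nat.

Definition tval := nat -> bool.

Definition asg := AP -> option tval.

Definition apset := AP -> Prop.
Definition asgset := asg -> Prop.
Definition hyper := asgset -> Prop.

Definition asg_dom (chi : asg) (P : apset) : Prop :=
  forall q, P q <-> chi q <> None.

Definition upd (chi : asg) (p : AP) (f : tval) : asg :=
  fun q => if Nat.eqb q p then Some f else chi q.

(* value of proposition q at time t under chi (only used for q in dom chi) *)
Definition aval (chi : asg) (t : nat) (q : AP) : bool :=
  match chi q with Some f => f t | None => false end.

Inductive ltl : Type :=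
| LTrue : ltl
| LAtom : AP -> ltl
| LNot : ltl -> ltl
| LAnd : ltl -> ltl -> ltl
| LOr : ltl -> ltl -> ltl
| LNext : ltl -> ltl
| LUntil : ltl -> ltl -> ltl.

Fixpoint ltl_atoms (psi : ltl) : list AP :=
  match psi with
  | LTrue => []
  | LAtom q => [q]
  | LNot a | LNext a => ltl_atoms a
  | LAnd a b | LOr a b | LUntil a b => ltl_atoms a ++ ltl_atoms b
  end.

Fixpoint ltl_holds (w : nat -> AP -> bool) (i : nat) (psi : ltl) : Prop :=
  match psi with
  | LTrue => True
  | LAtom q => w i q = true
  | LNot a => ~ ltl_holds w i a
  | LAnd a b => ltl_holds w i a /\ ltl_holds w i b
  | LOr a b => ltl_holds w i a \/ ltl_holds w i b
  | LNext a => ltl_holds w (S i) a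
  | LUntil a b => exists j, i <= j /\ ltl_holds w j b /\
                   (forall k, i <= k -> k < j -> ltl_holds w k a)
  end.

Definition ltl_sat (chi : asg) (psi : ltl) : Prop := ltl_holds (aval chi) 0 psi.

Inductive qptl : Type :=
| QL : ltl -> qptl
| QNot : qptl -> qptl
| QAnd : qptl -> qptl -> qptl
| QOr : qptl -> qptl -> qptl
| QEx : AP -> qptl -> qptl
| QAll : AP -> qptl -> qptl.

Fixpoint qfree (phi : qptl) (q : AP) : Prop :=
  match phi with
  | QL psi => In q (ltl_atoms psi)
  | QNot a => qfree a q
  | QAnd a b | QOr a b => qfree a q \/ qfree b q
  | QEx p a | QAll p a => qfree a q /\ q <> p
  end.

Fixpoint qsat (chi : asg) (phi : qptl) : Prop :=
  match phi with
  | QL psi => ltl_sat chi psi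
  | QNot a => ~ qsat chi a
  | QAnd a b => qsat chi a /\ qsat chi b
  | QOr a b => qsat chi a \/ qsat chi b
  | QEx p a => exists f : tval, qsat (upd chi p f) a
  | QAll p a => forall f : tval, qsat (upd chi p f) a
  end.

Definition dual (X : hyper) : hyper :=
  fun Y => exists c : asgset -> asg,
      (forall S, X S -> S (c S)) /\
      (forall a, Y a <-> exists S, X S /\ a = c S).

Definition approx (P : apset) (p : AP) (k : nat) (c1 c2 : asg) : Prop :=
  (forall q, P q -> q <> p -> c1 q = c2 q) /\
  (forall t, t <= k -> aval c1 t p = aval c2 t p).

(* functors over P (values on Asg(P) matter), behavioral w.r.t. every p in P *)
Definition behavioral (P : apset) (F : asg -> tval) : Prop :=
  forall p, P p -> forall (c1 c2 : asg) (k : nat),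
    asg_dom c1 P -> asg_dom c2 P -> approx P p k c1 c2 -> F c1 k = F c2 k.

Definition ext (S : asgset) (F : asg -> tval) (p : AP) : asgset :=
  fun a => exists chi, S chi /\ a = upd chi p (F chi).

(* ext_B(X,p), where P = ap(X) *)
Definition extB (P : apset) (X : hyper) (p : AP) : hyper :=
  fun Y => exists S F, X S /\ behavioral P F /\ (forall a, Y a <-> ext S F p a).

Inductive quant : Type := QuEx | QuAll.
Inductive flag : Type := FEA (* exists-forall *) | FAE (* forall-exists *).

Record gfg : Type := mkGfg { gprefix : list (quant * AP); gmatrix : ltl }.

Definition gfg_wf (phi : gfg) : Prop := NoDup (map snd (gprefix phi)).

Definition gfree (phi : gfg) (q : AP) : Prop :=
  In q (ltl_atoms (gmatrix phi)) /\ ~ In q (map snd (gprefix phi)).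

Definition add_ap (P : apset) (p : AP) : apset := fun q => P q \/ q = p.

(* gsat_pre P qs psi fl X : X |=^{fl} qs.psi, where P = ap(X) *)
Fixpoint gsat_pre (P : apset) (qs : list (quant * AP)) (psi : ltl)
    (fl : flag) (X : hyper) : Prop :=
  match qs with
  | [] =>
      match fl with
      | FEA => exists S, X S /\ forall chi, S chi -> ltl_sat chi psi
      | FAE => forall S, X S -> exists chi, S chi /\ ltl_sat chi psi
      end
  | (QuEx, p) :: qs' =>
      match fl with
      | FEA => gsat_pre (add_ap P p) qs' psi FEA (extB P X p)
      | FAE => (* X |=^AE E p.phi  iff  dual X |=^EA E p.phi *)
               gsat_pre (add_ap P p) qs' psi FEA (extB P (dual X) p)
      end
  | (QuAll, p) :: qs' =>
      match fl with
      | FAE => gsat_pre (add_ap P p) qs' psi FAE (extB P X p)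
      | FEA => (* X |=^EA A p.phi  iff  dual X |=^AE A p.phi *)
               gsat_pre (add_ap P p) qs' psi FAE (extB P (dual X) p)
      end
  end.

Definition gsat (P : apset) (X : hyper) (fl : flag) (phi : gfg) : Prop :=
  gsat_pre P (gprefix phi) (gmatrix phi) fl X.

Definition single (chi : asg) : hyper :=
  fun S => forall a, S a <-> a = chi.

(* Main.v *)
From mathcomp Require Import all_boot.
From mathcomp Require Import boolp zify.
Require Import Defs.

(** A formula is identified with a set of infinite words.  Call such a set recognizable if it is
    invariant under replacing the blocks of a factorization by blocks of the same type, for a
    finite-valued congruence on finite words.  LTL sets are recognizable and recognizable sets
    are closed under Boolean operations, under quantification of a proposition and, more
    generally, under the game in which in every round the quantifiers of a prefix choose, in
    order, the present values of their propositions: the type of a block is then the family of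
    sets of types that the existential player can force on it.  A recognizable set has a normal
    form [exists p1 ... pn. psi] with [psi] in LTL, guessing a factorization of Ramsey type.

    On a singleton, a behavioral prefix [Q1 p1 ... Qn pn] unfolds to quantification over causal
    functors in the reversed order [Qn Fn ... Q1 F1].  A winning strategy of either player in
    the game decides this value in favour of that player: eliminating the last column of the
    game by a functor consistent with the strategy leaves a winning strategy in the game for
    the shorter prefix.  As the game is determined, the behavioral formula means that the
    existential player wins, which is recognizable, hence expressible in QPTL.  Conversely the
    normal form of a QPTL formula is purely existential, and there behavioral and Tarski
    quantification agree.

    Determinacy is proved for Muller conditions by Zielonka's induction on the set of colours.
    To apply it, colours of finite prefixes have to determine membership in a recognizable set:
    positions are merged when the words from them to the end of the prefix have the same type,
    and the colours record which leaders of classes die and what they absorb. *)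

Set Implicit Arguments.
Unset Strict Implicit.
Unset Printing Implicit Defensive.

(** * Segments, shifts and factorizations of infinite words *)

Definition letter := AP -> bool.
Definition word := nat -> letter.

Definition seg (w : word) i j : seq letter := [seq w k | k <- iota i (j - i)].
Definition shift d (w : word) : word := fun t => w (d + t).
Definition cut (c : nat -> nat) := c 0 = 0 /\ forall i, c i < c i.+1.

Lemma size_seg w i j : size (seg w i j) = j - i.
Proof. by rewrite size_map size_iota. Qed.

Lemma seg_cat w i j k : i <= j -> j <= k -> seg w i j ++ seg w j k = seg w i k.
Proof.
move=> ij jk; rewrite /seg -map_cat; have -> : k - i = (j - i) + (k - j) by lia.
by rewrite iotaD subnKC.
Qed.

Lemma seg1 w i : seg w i i.+1 = [:: w i].
Proof. by rewrite /seg subSnn. Qed.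

Lemma segii w i : seg w i i = [::].
Proof. by rewrite /seg subnn. Qed.

Lemma seg_rcons w i j : i <= j -> seg w i j.+1 = rcons (seg w i j) (w j).
Proof. by move=> ij; rewrite -(@seg_cat w i j j.+1) // seg1 cats1. Qed.

Lemma seg_cons w i j : i < j -> seg w i j = w i :: seg w i.+1 j.
Proof. by move=> ij; rewrite -(@seg_cat w i i.+1 j) // seg1. Qed.

Lemma drop_seg w i j k : drop k (seg w i j) = seg w (i + k) j.
Proof. by rewrite /seg -map_drop drop_iota subnDA. Qed.

Lemma take_seg w j k : k <= j -> take k (seg w 0 j) = seg w 0 k.
Proof. by move=> kj; rewrite -(@seg_cat w 0 k j) // take_size_cat // size_seg subn0. Qed.

Lemma seg_shift d w i j : seg (shift d w) i j = seg w (d + i) (d + j).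
Proof. by rewrite /seg subnDl iotaDl -map_comp. Qed.

Lemma shiftD d e w : shift d (shift e w) = shift (e + d) w.
Proof. by apply: funext => t; rewrite /shift addnA. Qed.

Lemma cut_mono c i j : cut c -> i <= j -> c i <= c j.
Proof. by case=> _ h ij; rewrite -(subnKC ij); elim: (j - i) => [|n]; rewrite ?addn0 ?addnS //; have := h (i + n); lia. Qed.

Lemma cut_ge c i : cut c -> i <= c i.
Proof. by case=> h0 h; elim: i => [//|i]; have := h i; lia. Qed.

Lemma cut_block c t : cut c -> exists i, c i <= t < c i.+1.
Proof.
move=> hc; elim: t => [|t [i hi]].
  by exists 0; case: hc => h0 h; have := h 0; rewrite h0; lia.
have [lt|ge] := ltnP t.+1 (c i.+1); first by exists i; lia.
by exists i.+1; case: hc => _ h; have := h i.+1; lia.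
Qed.

Lemma cut_block_inj c i j t : cut c -> c i <= t < c i.+1 -> c j <= t < c j.+1 -> i = j.
Proof.
move=> hc hi hj; apply/eqP; rewrite eqn_leq; apply/andP; split; rewrite leqNgt; apply/negP => lt.
  by have := cut_mono hc lt; lia.
by have := cut_mono hc lt; lia.
Qed.

(** * Recognizable sets of infinite words *)

Definition congr_type (T : Type) (ty : seq letter -> T) :=
  forall u u' v v', ty u = ty u' -> ty v = ty v' -> ty (u ++ v) = ty (u' ++ v').

Definition same_blocks (T : Type) (ty : seq letter -> T) w c w' c' :=
  [/\ cut c, cut c' &
      forall i, ty (seg w (c i) (c i.+1)) = ty (seg w' (c' i) (c' i.+1))].

(** The kernel of [ty] is a congruence, so [ty] acts as a morphism to a semigroup whose product is
    never named. One implication suffices, as [same_blocks] is symmetric. *)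
Definition recog_by (T : Type) (ty : seq letter -> T) (L : word -> Prop) :=
  congr_type ty /\ forall w c w' c', same_blocks ty w c w' c' -> L w -> L w'.

Definition recog (L : word -> Prop) :=
  exists (T : finType) (ty : seq letter -> T), recog_by ty L.

Lemma same_blocks_sym T (ty : seq letter -> T) w c w' c' :
  same_blocks ty w c w' c' -> same_blocks ty w' c' w c.
Proof. by case=> h h' e; split. Qed.

Lemma same_blocks_map T T' (ty : seq letter -> T) (f : T -> T') w c w' c' :
  same_blocks ty w c w' c' -> same_blocks (fun u => f (ty u)) w c w' c'.
Proof. by case=> h h' e; split=> // i; rewrite e. Qed.

Lemma recog_ext (L L' : word -> Prop) : (forall w, L w <-> L' w) -> recog L -> recog L'.
Proof. by move=> e [T [ty [h1 h2]]]; exists T, ty; split=> // w c w' c' /h2 h /e /h /e. Qed.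

Lemma recog_not L : recog L -> recog (fun w => ~ L w).
Proof.
move=> [T [ty [h1 h2]]]; exists T, ty; split=> // w c w' c' hs nL L'.
by apply: nL; apply: h2 (same_blocks_sym hs) L'.
Qed.

Lemma recog_pair L L' : recog L -> recog L' ->
  exists (T : finType) (ty : seq letter -> T), recog_by ty L /\ recog_by ty L'.
Proof.
move=> [T [ty [h1 h2]]] [T' [ty' [h1' h2']]].
exists (T * T')%type, (fun u => (ty u, ty' u)).
have hc : congr_type (fun u => (ty u, ty' u)).
  by move=> u u' v v' [a b] [c d]; rewrite (h1 u u' v v') // (h1' u u' v v').
split; split=> // w c w' c' hs.
  by apply: h2 (same_blocks_map fst hs).
by apply: h2' (same_blocks_map snd hs).
Qed.

Lemma recog_and L L' : recog L -> recog L' -> recog (fun w => L w /\ L' w).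
Proof.
move=> r r'; have [T [ty [[h1 h2] [_ h2']]]] := recog_pair r r'.
exists T, ty; split=> // w c w' c' hs [a b]; split.
  exact: h2 hs a.
exact: h2' hs b.
Qed.

Lemma recog_or L L' : recog L -> recog L' -> recog (fun w => L w \/ L' w).
Proof.
move=> r r'; have := recog_not (recog_and (recog_not r) (recog_not r')).
apply: recog_ext => w; split; last by tauto.
by move=> h; apply: contrapT; tauto.
Qed.

Lemma recog_true : recog (fun _ => True).
Proof. by exists unit, (fun=> tt); split. Qed.

Lemma recog_atom q : recog (fun w => w 0 q = true).
Proof.
exists (option bool), (fun u => if u is a :: _ then Some (a q) else None); split.
  by move=> [|a u] [|a' u'] v v' //= [].
move=> w c w' c' [[c0 hc] [c0' hc'] /(_ 0)].
by rewrite c0 c0' !seg_cons //; [move=> [->]| have := hc' 0; lia | have := hc 0; lia].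
Qed.

(** The suffixes start before the end of block [i]: the segment up to that end becomes the first
    block of a factorization of the suffix, and the later blocks are kept. *)
Lemma recog_tail T (ty : seq letter -> T) L w c w' c' i k k' :
  recog_by ty L -> cut c -> cut c' -> k < c i.+1 -> k' < c' i.+1 ->
  ty (seg w k (c i.+1)) = ty (seg w' k' (c' i.+1)) ->
  (forall m, i < m -> ty (seg w (c m) (c m.+1)) = ty (seg w' (c' m) (c' m.+1))) ->
  L (shift k w) -> L (shift k' w').
Proof.
move=> [_ h2] hc hc' lk lk' e em.
pose d (c : nat -> nat) k m := if m is m'.+1 then c (i + m) - k else 0.
apply: (h2 _ (d c k) _ (d c' k')).
have hd c0 k0 : cut c0 -> k0 < c0 i.+1 -> cut (d c0 k0).
  move=> hc0 lk0; split=> // -[|m] /=; rewrite ?addn1; first lia.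
  have := hc0.2 (i + m.+1); have := @cut_mono c0 i.+1 (i + m.+1) hc0.
  by rewrite (addnS i m.+1); lia.
split; [exact: hd|exact: hd|].
have kd c0 k0 m : cut c0 -> k0 < c0 i.+1 -> k0 + d c0 k0 m.+1 = c0 (i + m.+1).
  move=> hc0 lk0 /=; rewrite subnKC //; have := @cut_mono c0 i.+1 (i + m.+1) hc0; lia.
case=> [|m]; rewrite !seg_shift !kd //=; first by rewrite !addn0 addn1.
by rewrite !(addnS i m.+1); apply: em; lia.
Qed.

(** A block type also records the type of the block without its first letter, and whether the block
    is empty: only then can the first letter of [u ++ v] come from [v]. *)
Lemma recog_next L : recog L -> recog (fun w => L (shift 1 w)).
Proof.
move=> [T [ty hr]]; have h1 := hr.1.
pose ty' u := (nilp u, ty u, ty (behead u)).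
have hc : congr_type ty'.
  move=> [|a u] [|a' u'] v v' //; rewrite /ty' /= => -[e1 e2] [e3 e4 e5].
  by rewrite (h1 u u' v v') // (h1 (a :: u) (a' :: u') v v').
exists (bool * T * T)%type, ty'; split=> // w c w' c' [hcut hcut' e].
(* The first two blocks are merged so that position 1 lies in the first block. *)
have hb w0 c0 : cut c0 -> behead (seg w0 0 (c0 2)) = seg w0 1 (c0 2).
  by move=> [_ h]; rewrite seg_cons //; have := h 0; have := h 1; lia.
have hb1 c0 : cut c0 -> 1 < c0 2.
  by move=> [h0 h]; have := h 0; have := h 1; lia.
have e2 : ty' (seg w 0 (c 2)) = ty' (seg w' 0 (c' 2)).
  rewrite -(@seg_cat w 0 (c 1)) ?(cut_mono (i:=1)) //.
  rewrite -(@seg_cat w' 0 (c' 1)) ?(cut_mono (i:=1)) //.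
  by apply: hc; [have := e 0; rewrite hcut.1 hcut'.1|exact: e 1].
apply: (recog_tail (c := c) (c' := c') (i := 1) hr) => //; try exact: hb1.
  by move: e2 => [_ _]; rewrite !hb.
by move=> m _; have [_ -> _] := e m.
Qed.

(** With the later blocks fixed, the truth of [La] and [Lb] at a position depends only on the type
    of the rest of its block. A block type therefore records the pairs [g] of sets of types for
    which [g.1] until [g.2] occurs in the block. *)
Lemma recog_until La Lb : recog La -> recog Lb ->
  recog (fun w => exists j, Lb (shift j w) /\ forall k, k < j -> La (shift k w)).
Proof.
move=> ra rb; have [T [ty [hra hrb]]] := recog_pair ra rb; have h1 := hra.1.
pose G := ({set T} * {set T})%type.
pose A u (Ga : {set T}) := forall k, k < size u -> ty (drop k u) \in Ga.
pose U u (g : G) := exists2 k, k < size u & ty (drop k u) \in g.2 /\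
   forall k', k' < k -> ty (drop k' u) \in g.1.
pose ty' u := (ty u, [set g : G | `[< U u g >]]).
have UE u u' : ty' u = ty' u' -> forall g, U u g <-> U u' g.
  move=> [_ e] g; move/setP: e => /(_ g); rewrite !inE => e.
  by split=> /asboolP h; apply/asboolP; rewrite -?e // e.
(* A condition holding throughout the block is the failure of an instance of [U], so the recorded
   type determines it too. *)
have AU u Ga : A u Ga <-> ~ U u (setT, ~: Ga).
  split=> [hA [k hk /= [h _]]|hU k hk].
    by move: h; rewrite inE hA.
  apply: contrapT => h; apply: hU; exists k => //=; split; last by [].
  by rewrite inE; apply/negP.
have AE u u' : ty' u = ty' u' -> forall g, A u g <-> A u' g.
  by move=> e g; rewrite !AU (UE _ _ e).
(* The residual by [v] turns a condition on suffixes of [u ++ v] into one on suffixes of [u]. *)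
pose quo (Ga : {set T}) v := [set t : T | `[< exists u, ty u = t /\ ty (u ++ v) \in Ga >]].
have quoE Ga u v : (ty u \in quo Ga v) = (ty (u ++ v) \in Ga).
  rewrite inE; apply/asboolP/idP => [[x [e]]|h]; last by exists u.
  by rewrite (h1 x u v v).
have quo_ty Ga v v' : ty v = ty v' -> quo Ga v = quo Ga v'.
  move=> e; apply/setP => t; rewrite !inE; apply: asbool_equiv_eq.
  by split=> -[x [ex hx]]; exists x; move: hx; rewrite (h1 x x v v').
have dcat k u v : k < size u -> drop k (u ++ v) = drop k u ++ v.
  by move=> hk; rewrite drop_cat hk.
have dcat2 k u v : drop (size u + k) (u ++ v) = drop k v.
  by rewrite drop_cat ltnNge leq_addr /= addKn.
have Ucat u v g : U (u ++ v) g <->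
    U u (quo g.1 v, quo g.2 v) \/ (A u (quo g.1 v) /\ U v g).
  split.
    move=> [k]; rewrite size_cat => hk [hb ha].
    have [lt|ge] := ltnP k (size u).
      left; exists k => //=; split; first by rewrite quoE -dcat.
      by move=> k' lk; rewrite quoE -dcat ?ha //; lia.
    right; split.
      by move=> k' lk; rewrite quoE -dcat // ha //; lia.
    exists (k - size u); first lia.
    split; first by rewrite -(dcat2 _ _ u) subnKC.
    by move=> k' lk; rewrite -(dcat2 _ _ u) ha //; lia.
  move=> [[k hk [hb ha]]|[hA [k hk [hb ha]]]].
    exists k; first by rewrite size_cat; lia.
    split; first by rewrite dcat // -quoE.
    by move=> k' lk; rewrite dcat -?quoE ?ha //; lia.
  exists (size u + k); first by rewrite size_cat; lia.
  split; first by rewrite dcat2.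
  move=> k' lk; have [lt|ge] := ltnP k' (size u).
    by rewrite dcat // -quoE hA.
  by rewrite -(subnKC ge) dcat2 ha //; lia.
have hc : congr_type ty'.
  move=> u u' v v' eu ev; have [eu1 _] := eu; have [ev1 _] := ev.
  rewrite /ty' (h1 u u' v v') //; congr pair.
  apply/setP => g; rewrite !inE; apply: asbool_equiv_eq.
  rewrite !Ucat (quo_ty _ _ _ ev1) (quo_ty g.2 _ _ ev1) (UE _ _ eu) (AE _ _ eu).
  by rewrite (UE _ _ ev).
exists (T * {set G})%type, ty'; split=> // w c w' c' [hcut hcut' e] [j [hj ha]].
have et m : ty (seg w (c m) (c m.+1)) = ty (seg w' (c' m) (c' m.+1)) by have [] := e m.
(* The types of segments of [w] that end with block [i] and start where [L] holds; by [recog_tail]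
   such a type guarantees [L] in [w'] as well. *)
pose S (L : word -> Prop) i : {set T} :=
  [set t | `[< exists2 k, k < c i.+1 & ty (seg w k (c i.+1)) = t /\ L (shift k w) >]].
have SL (L : word -> Prop) i k' : recog_by ty L -> k' < c' i.+1 ->
    ty (seg w' k' (c' i.+1)) \in S L i -> L (shift k' w').
  move=> hr lk'; rewrite inE => /asboolP [k lk [ek Lk]].
  exact: (recog_tail (c := c) (c' := c') hr hcut hcut' lk lk' ek (fun m _ => et m) Lk).
have LS (L : word -> Prop) i k : k < c i.+1 -> L (shift k w) ->
    ty (seg w k (c i.+1)) \in S L i.
  by move=> lk Lk; rewrite inE; apply/asboolP; exists k.
have [i hi] := cut_block j hcut.
have hA m : m < i -> A (seg w' (c' m) (c' m.+1)) (S La m).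
  move=> lm; apply/(AE _ _ (e m)) => k; rewrite size_seg => lk.
  rewrite drop_seg; apply: LS; first lia.
  by apply: ha; have := cut_mono hcut lm; lia.
have : U (seg w' (c' i) (c' i.+1)) (S La i, S Lb i).
  apply/(UE _ _ (e i)); exists (j - c i); first by rewrite size_seg; lia.
  split=> /=; first by rewrite drop_seg subnKC; [apply: LS => //; lia|lia].
  by move=> k lk; rewrite drop_seg; apply: LS; [lia|apply: ha; lia].
move=> [k]; rewrite size_seg drop_seg => lk /= [hb' ha'].
exists (c' i + k); split; first by apply: SL hb' => //; lia.
move=> k' lk'; have [m hm] := cut_block k' hcut'.
have lmi : m <= i.
  by rewrite leqNgt; apply/negP => lt; have := cut_mono hcut' lt; lia.
have [eqm|ltm] : m = i \/ m < i by lia.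
  subst m; apply: (SL _ i) => //; first lia.
  by have := ha' (k' - c' i); rewrite drop_seg subnKC; [apply; lia|lia].
have := hA m ltm (k' - c' m); rewrite size_seg drop_seg subnKC; last lia.
by move=> h; apply: SL (h _) => //; lia.
Qed.

Lemma ltl_holds_shift w i psi : ltl_holds w i psi <-> ltl_holds (shift i w) 0 psi.
Proof.
elim: psi w i => [|q|a IHa|a IHa b IHb|a IHa b IHb|a IHa|a IHa b IHb] w i //=.
- by rewrite /shift addn0.
- by rewrite IHa.
- by rewrite IHa IHb.
- by rewrite IHa IHb.
- by rewrite IHa (IHa (shift i w) 1) shiftD addn1.
split=> -[j [ij [hj hk]]].
  exists (j - i); split; first lia.
  split; first by rewrite IHb shiftD subnKC; [rewrite -IHb|lia].
  by move=> k _ lk; rewrite IHa shiftD -IHa; apply: hk; lia.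
exists (i + j); split; first lia.
split; first by rewrite IHb -shiftD -IHb.
move=> k ik lk; rewrite -(@subnKC i k); last lia.
by rewrite IHa -shiftD -IHa; apply: hk; lia.
Qed.

Lemma recog_ltl psi : recog (fun w => ltl_holds w 0 psi).
Proof.
elim: psi => [|q|a IHa|a IHa b IHb|a IHa b IHb|a IHa|a IHa b IHb] /=.
- exact: recog_true.
- exact: recog_atom.
- exact: recog_not.
- exact: recog_and.
- exact: recog_or.
- by apply: recog_ext (recog_next IHa) => w; rewrite -ltl_holds_shift.
apply: recog_ext (recog_until IHa IHb) => w; split=> -[j].
  move=> [hj hk]; exists j; split; first lia.
  by split=> [|k _ lk]; rewrite ltl_holds_shift //; apply: hk; lia.
move=> [_ [hj hk]]; exists j; split; first by rewrite -ltl_holds_shift.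
by move=> k lk; rewrite -ltl_holds_shift; apply: hk; lia.
Qed.

(** * Infinite recurrence, merging of positions and colours of finite prefixes *)

Definition infm (P : nat -> Prop) := forall N, exists2 m, N <= m & P m.

Lemma not_infm P : ~ infm P -> exists N, forall m, N <= m -> ~ P m.
Proof.
move=> h; apply: contrapT => h'; apply: h => N; apply: contrapT => h2.
by apply: h'; exists N => m Nm Pm; apply: h2; exists m.
Qed.

Lemma infm_sub (P Q : nat -> Prop) : (forall m, P m -> Q m) -> infm P -> infm Q.
Proof. by move=> h hP N; have [m Nm /h Qm] := hP N; exists m. Qed.

Lemma infm_pigeon (T : finType) (f : nat -> T) P :
  infm P -> exists e, infm (fun m => P m /\ f m = e).
Proof.
move=> hP; apply: contrapT => h.
have /choice[g hg] : forall e, exists N, forall m, N <= m -> ~ (P m /\ f m = e).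
  by move=> e; apply: not_infm => he; apply: h; exists e.
have [m hm Pm] := hP (\max_e g e).
by apply: (hg (f m) m) => //; apply: leq_trans hm; apply: leq_bigmax.
Qed.

Section Merging.

Variables (T : finType) (ty : seq letter -> T).
Hypothesis tyC : congr_type ty.

Lemma merge_mono w i j m m' : i <= m -> j <= m -> m <= m' ->
  ty (seg w i m) = ty (seg w j m) -> ty (seg w i m') = ty (seg w j m').
Proof.
by move=> im jm mm' e; rewrite -(seg_cat _ im mm') -(seg_cat _ jm mm'); apply: tyC.
Qed.

Definition merges w i j := exists m, [/\ i <= m, j <= m & ty (seg w i m) = ty (seg w j m)].

Lemma merges_trans w i j k : merges w i j -> merges w j k -> merges w i k.
Proof.
move=> [m [a b c]] [m' [a' b' c']]; exists (maxn m m'); split; [lia|lia|].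
rewrite (merge_mono a b (leq_maxl m m') c); apply: merge_mono c' => //; lia.
Qed.

Definition stab w i e := infm (fun j => [/\ i < j, merges w i j & ty (seg w i j) = e]).

(** Each cut point is chosen beyond a point where [i] and the previous cut point have merged; the
    block between the two then has the type of the segment from [i], which is [e]. This replaces
    Ramsey's theorem. *)
Lemma stab_cut w i e : stab w i e -> exists c, [/\ cut c, i < c 1,
  ty (seg w i (c 1)) = e & forall n, 0 < n -> ty (seg w (c n) (c n.+1)) = e].
Proof.
move=> hs.
have /choice[next hn] : forall N, exists j, N <= j /\ [/\ i < j, merges w i j & ty (seg w i j) = e].
  by move=> N; have [j] := hs N; exists j.
have /choice[mg hm] : forall j, exists m, merges w i j ->
    [/\ i <= m, j < m & ty (seg w i m) = ty (seg w j m)].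
  move=> j; have [[m [a b c]]|h] := pselect (merges w i j); last by exists 0.
  (* The successor puts the merging point strictly after [j], so that the cut points increase. *)
  by exists m.+1 => _; split; [lia|lia|apply: merge_mono c].
pose fix g n := if n is n'.+1 then next (mg (g n')) else next 0.
have gP n : [/\ i < g n, merges w i (g n) & ty (seg w i (g n)) = e].
  by case: n => [|n]; exact: (proj2 (hn _)).
pose c n := if n is n'.+1 then g n' else 0.
have cS n : mg (g n) <= g n.+1 by exact: (proj1 (hn _)).
exists c; split.
- split=> // -[|n]; first by have [] := gP 0 => /=; lia.
  by have [_ /hm[_ ? _] _] := gP n; have := cS n => /=; lia.
- by have [] := gP 0.
- by have [] := gP 0.
case=> // n _ /=.
have [_ /hm[h1 h2 h3] _] := gP n.
have [_ _ <-] := gP n.+1.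
by symmetry; apply: merge_mono h3 => //; exact: ltnW.
Qed.

Lemma stab_recog L w w' i i' e : recog_by ty L ->
  stab w i e -> stab w' i' e -> ty (seg w 0 i) = ty (seg w' 0 i') -> L w -> L w'.
Proof.
move=> [_ h] /stab_cut[c [hc lc ec hn]] /stab_cut[c' [hc' lc' ec' hn']] e0.
apply: (h _ c _ c'); split=> // -[|n]; last by rewrite hn ?hn'.
rewrite hc.1 hc'.1 -(seg_cat _ (leq0n i) (ltnW lc)) -(seg_cat _ (leq0n i') (ltnW lc')).
by apply: tyC => //; rewrite ec ec'.
Qed.

(** The leader of a class of positions is its least member. By [rep_step] a position that has lost
    this role never regains it. *)
Definition rep (v : seq letter) i :=
  i < size v /\ forall k, k < i -> ty (drop k v) <> ty (drop i v).

Fixpoint rk (v : seq letter) i := if i is i'.+1 then rk v i' + `[< rep v i' >] else 0.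

Lemma rk_mono v i j : i <= j -> rk v i <= rk v j.
Proof. by move=> ij; rewrite -(subnKC ij); elim: (j - i) => [|n]; rewrite ?addn0 ?addnS /=; lia. Qed.

Lemma rk_lt v i j : rep v i -> i < j -> rk v i < rk v j.
Proof.
move=> /asboolP ri ij; apply: leq_trans (rk_mono v ij) => /=.
by rewrite ri addn1.
Qed.

Lemma rk_sub v v' i : (forall k, k < i -> rep v' k -> rep v k) -> rk v' i <= rk v i.
Proof.
elim: i => //= i IH h; apply: leq_add; first by apply: IH => k lk; apply: h; lia.
by case: asboolP => // /h h'; rewrite asboolT //; apply: h'.
Qed.

Lemma rk_sub_lt v v' i k : (forall k, k < i -> rep v' k -> rep v k) ->
  k < i -> rep v k -> ~ rep v' k -> rk v' i < rk v i.
Proof.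
move=> h lk r nr; have h1 : rk v' k <= rk v k by apply: rk_sub => j lj; apply: h; lia.
have : rk v' k.+1 < rk v k.+1 by rewrite /= asboolF // asboolT //; lia.
elim: i h lk => // i IH h lk h2.
have [->//|ne] := eqVneq i k; have {}lk : k < i by lia.
have h3 : rk v' i < rk v i by apply: IH => // j lj; apply: h; lia.
rewrite /= -addSn; apply: leq_add => //.
by case: asboolP => // /h h'; rewrite asboolT //; apply: h'.
Qed.

(** Distinct leaders have distinct types. *)
Lemma rk_bound v i : rk v i <= #|T|.
Proof.
pose S i := [set t | `[< exists2 k, k < i & rep v k /\ ty (drop k v) = t >]].
suff : rk v i <= #|S i| by move/leq_trans; apply; exact: max_card.
elim: i => //= i IH.
have sub : S i \subset S i.+1.
  apply/subsetP => t; rewrite !inE => /asboolP[k lk h]; apply/asboolP.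
  by exists k => //; lia.
case: asboolP => ri; last by rewrite addn0; apply: leq_trans (subset_leq_card sub).
rewrite addn1; apply: leq_ltn_trans IH _; apply: proper_card; apply/properP; split=> //.
exists (ty (drop i v)); first by rewrite inE; apply/asboolP; exists i.
by rewrite inE; apply/asboolP => -[k lk [_]]; apply: ri.2.
Qed.

(** The event belongs to the last letter of [v]: leader and rank are taken in the prefix one letter
    shorter. *)
Definition killed l (v : seq letter) := exists k,
  [/\ rep (take (size v).-1 v) k, rk (take (size v).-1 v) k <= l & ~ rep v k].

(** The last clause dates the merging of [i] and [j] to the last letter, so for fixed [i] and [j]
    the event occurs at most once along a word. *)
Definition absorbs l s e (v : seq letter) := exists i j,
  [/\ rep v i, rk v i = l, ty (take i v) = s &
   [/\ i < j < size v, ty (drop i (take j v)) = e, ty (drop i v) = ty (drop j v) &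
    forall m, j < m < size v -> ty (drop i (take m v)) <> ty (drop j (take m v))]].

Definition color := ('I_#|T|.+1 + 'I_#|T|.+1 * T * T)%type.

Definition event (v : seq letter) (c : color) :=
  match c with
  | inl l => killed l v
  | inr (l, s, e) => absorbs l s e v
  end.

Lemma repP w m i : rep (seg w 0 m) i <->
  i < m /\ forall k, k < i -> ty (seg w k m) <> ty (seg w i m).
Proof.
rewrite /rep size_seg subn0; split=> -[h1 h2]; split=> // k /h2; by rewrite !drop_seg !add0n.
Qed.

Lemma rep_step w m i : i < m -> rep (seg w 0 m.+1) i -> rep (seg w 0 m) i.
Proof.
move=> im /repP[_ h]; apply/repP; split=> // k ki e; apply: (h k ki).
by apply: merge_mono e; lia.
Qed.

Lemma killedP w m l : killed l (seg w 0 m.+1) <-> exists k,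
  [/\ rep (seg w 0 m) k, rk (seg w 0 m) k <= l & ~ rep (seg w 0 m.+1) k].
Proof. by rewrite /killed size_seg subn0 /= take_seg. Qed.

Lemma absorbsP w m l s e : absorbs l s e (seg w 0 m) <-> exists i j,
  [/\ rep (seg w 0 m) i, rk (seg w 0 m) i = l, ty (seg w 0 i) = s &
   [/\ i < j < m, ty (seg w i j) = e, ty (seg w i m) = ty (seg w j m) &
    forall m', j < m' < m -> ty (seg w i m') <> ty (seg w j m')]].
Proof.
rewrite /absorbs size_seg subn0; split=> -[i [j [h1 h2 h3 [h4 h5 h6 h7]]]].
  exists i, j; move: h3 h5 h6; rewrite !drop_seg !take_seg ?drop_seg ?add0n; try lia.
  split=> //; split=> // m' hm; have := h7 m' hm.
  by rewrite !take_seg ?drop_seg ?add0n //; lia.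
exists i, j; rewrite !drop_seg !take_seg ?drop_seg ?add0n; try lia.
split=> //; split=> // m' hm; have := h7 m' hm.
by rewrite !take_seg ?drop_seg ?add0n //; lia.
Qed.

(** Take the least [i] that merges with infinitely many positions. By minimality it is always a
    leader, and its rank never grows, so it settles at some [l]; [e] is found by pigeonhole. *)
Lemma ex_stab w : exists (l : 'I_#|T|.+1) i e, [/\ stab w i e,
  ~ infm (fun m => killed l (seg w 0 m)) &
  infm (fun m => absorbs l (ty (seg w 0 i)) e (seg w 0 m))].
Proof.
have ex : exists i, `[< infm (fun k => merges w i k) >].
  apply: contrapT => h.
  have /choice[N hN] : forall i, exists N, forall k, N <= k -> ~ merges w i k.
    by move=> i; apply: not_infm => hi; apply: h; exists i; apply/asboolP.
  (* Otherwise [g] lists pairwise unmerged positions, and the segments from the first [#|T|.+1] of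
     them to the next one would have distinct types. *)
  pose fix g n := if n is n'.+1 then (g n').+1 + \max_(i < (g n').+1) N i else 0.
  have gm a b : a <= b -> g a <= g b.
    move=> ab; rewrite -(subnKC ab); elim: (b - a) => [|n IH]; rewrite ?addn0 ?addnS //.
    by apply: leq_trans IH _; rewrite /= addSn ltnW // ltnS leq_addr.
  have gN a b : a < b -> ~ merges w (g a) (g b).
    case: b => // b ab; apply: hN => /=.
    have lt : g a < (g b).+1 by rewrite ltnS; apply: gm.
    by apply: leq_trans (leq_addl _ _); apply: (leq_bigmax (Ordinal lt)).
  pose F (a : 'I_#|T|.+1) := ty (seg w (g a) (g #|T|.+1)).
  have : injective F.
    move=> a b; wlog ab : a b / a < b.
      move=> hw eF; have [lt|gt|/val_inj//] := ltngtP a b; first exact: hw.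
      by apply/esym/hw.
    move=> eF; exfalso; apply: (gN a b ab); exists (g #|T|.+1); split=> //; apply: gm; exact: ltnW.
  by move/leq_card; rewrite card_ord ltnn.
case: (ex_minnP ex) => i /asboolP hi imin.
have irep m : i < m -> rep (seg w 0 m) i.
  move=> im; apply/repP; split=> // k ki e.
  suff : i <= k by lia.
  apply: imin; apply/asboolP; apply: infm_sub hi => j; apply: merges_trans.
  by exists m; split=> //; lia.
have rkS m : i < m -> rk (seg w 0 m.+1) i <= rk (seg w 0 m) i.
  by move=> im; apply: rk_sub => k ki; apply: rep_step; lia.
have [m0 [im0 hm0]] : exists m0, i < m0 /\
    forall m, m0 <= m -> rk (seg w 0 m) i = rk (seg w 0 m0) i.
  pose P r := `[< exists2 m, i < m & rk (seg w 0 m) i = r >].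
  have exP : exists r, P r by exists (rk (seg w 0 i.+1) i); apply/asboolP; exists i.+1.
  case: (ex_minnP exP) => r /asboolP[m0 im0 <-] rmin; exists m0; split=> // m hm.
  apply/eqP; rewrite eqn_leq; apply/andP; split.
    rewrite -(subnKC hm); elim: (m - m0) => [|n IH]; rewrite ?addn0 ?addnS //.
    by apply: leq_trans (rkS _ _) IH; lia.
  by apply: rmin; apply/asboolP; exists m => //; lia.
pose l := rk (seg w 0 m0) i.
have hl : l < #|T|.+1 by rewrite ltnS; apply: rk_bound.
have [e he] := infm_pigeon (fun j => ty (seg w i j)) hi.
have hs : stab w i e.
  by move=> N; have [j hj [h1 h2]] := he (maxn N i.+1); exists j; [lia|split=> //; lia].
exists (Ordinal hl), i, e; split=> //.
  move=> /(_ m0.+1)[[//|m] hm /killedP[k [/= h1 h2 h3]]].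
  have rki m' : m0 <= m' -> rk (seg w 0 m') i = l by exact: hm0.
  (* Once the rank of [i] is settled, the death of a leader below [i] would lower it, leaders above
     [i] have larger rank, and [i] itself never dies. *)
  have [ki|ik|eik] := ltngtP k i.
  - have : rk (seg w 0 m.+1) i < rk (seg w 0 m) i.
      by apply: rk_sub_lt ki h1 h3 => k' hk'; apply: rep_step; lia.
    by rewrite !rki; lia.
  - have : rk (seg w 0 m) i < rk (seg w 0 m) k by apply: rk_lt => //; apply: irep; lia.
    by rewrite rki; lia.
  by apply: h3; rewrite eik; apply: irep; lia.
move=> N; have [j hj [ij [mm [h1 h2 h3]] ej]] := hs (maxn N m0).
have exm : exists m, `[< j < m /\ ty (seg w i m) = ty (seg w j m) >].
  exists mm.+1; apply/asboolP; split; first lia.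
  by apply: merge_mono h3; lia.
case: (ex_minnP exm) => m /asboolP[jm em] mmin; exists m; first lia.
apply/absorbsP; exists i, j; split=> //; first by apply: irep; lia.
  by rewrite hm0 //; lia.
split=> //; first lia.
move=> m' hm' e'; suff : m <= m' by lia.
by apply: mmin; apply/asboolP; split=> //; lia.
Qed.

(** When leaders of rank up to [l] stop dying, the leader of rank [l] is a fixed [i]. Each [j] is
    absorbed by it only once, so infinitely many absorptions involve infinitely many [j]. *)
Lemma absorbs_stab w l s e : ~ infm (fun m => killed l (seg w 0 m)) ->
  infm (fun m => absorbs l s e (seg w 0 m)) -> exists2 i, stab w i e & ty (seg w 0 i) = s.
Proof.
move=> /not_infm[m0 hk] ha; have [m1 hm1 /absorbsP[i [_ [ri rki hs _]]]] := ha m0.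
have inv m : m1 <= m -> rep (seg w 0 m) i /\ rk (seg w 0 m) i = l.
  move=> lm; rewrite -(subnKC lm); elim: (m - m1) => [|n [r k]]; rewrite ?addn0 ?addnS //.
  set m' := m1 + n in r k *.
  have nk k' : rep (seg w 0 m') k' -> rk (seg w 0 m') k' <= l -> rep (seg w 0 m'.+1) k'.
    move=> a b; apply: contrapT => c; apply: (hk m'.+1); first by rewrite /m'; lia.
    by apply/killedP; exists k'.
  have im : i < m' by have /repP[] := r.
  split; first by apply: nk; rewrite ?k.
  apply/eqP; rewrite -k eqn_leq; apply/andP; split; apply: rk_sub => k' lk'.
    by apply: rep_step; lia.
  by move=> r'; apply: nk => //; rewrite -k ltnW // rk_lt.
have uniq m i' : m1 <= m -> rep (seg w 0 m) i' -> rk (seg w 0 m) i' = l -> i' = i.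
  move=> /inv[r k] r' k'; have [lt|gt|//] := ltngtP i' i.
    by have := rk_lt r' lt; lia.
  by have := rk_lt r gt; lia.
exists i => // N; apply: contrapT => hN.
have bnd m : m1 <= m -> absorbs l s e (seg w 0 m) -> exists2 j, j < N &
    [/\ j < m, ty (seg w i m) = ty (seg w j m) &
     forall m', j < m' < m -> ty (seg w i m') <> ty (seg w j m')].
  move=> lm /absorbsP[i' [j [r k _ [h1 h2 h3 h4]]]].
  have ei := uniq m i' lm r k; subst i'.
  exists j; last by split=> //; lia.
  rewrite ltnNge; apply/negP => Nj; apply: hN; exists j => //; split=> //; first lia.
  by exists m; split=> //; lia.
pose Q j m := [/\ m1 <= m, j < m, ty (seg w i m) = ty (seg w j m) &
     forall m', j < m' < m -> ty (seg w i m') <> ty (seg w j m')].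
have /choice[f hf] : forall j, exists b, forall m, Q j m -> m <= b.
  move=> j; have [[b [hb hb1 hb2 hb3]]|no] := pselect (exists b, Q j b).
    exists b => m [_ jm em hm]; rewrite leqNgt; apply/negP => lt.
    by apply: (hm b) => //; lia.
  by exists 0 => m hm; case: no; exists m.
have [m hm ab] := ha (m1 + (\max_(j < N) f j).+1).
have [j lj [q1 q2 q3]] := bnd m (leq_trans (leq_addr _ _) hm) ab.
have lf : m <= f j by apply: hf; split=> //; apply: leq_trans (leq_addr _ _) hm.
have lb := leq_bigmax (F := fun j : 'I_N => f j) (Ordinal lj).
have := leq_trans hm (leq_trans lf lb).
by rewrite addnS ltnNge leq_addl.
Qed.

(** The recurring colours of [w] reveal the type of the prefix before [i] and the type [e]; the same
    pair is then found in [w'], and it determines membership. *)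
Lemma event_recog L w w' : recog_by ty L ->
  (forall c, infm (fun m => event (seg w 0 m) c) <-> infm (fun m => event (seg w' 0 m) c)) ->
  L w -> L w'.
Proof.
move=> hL hc; have [l [i [e [hs hk ha]]]] := ex_stab w.
have hk' : ~ infm (fun m => killed l (seg w' 0 m)) by move=> h; apply: hk; apply/(hc (inl l)).
have [i' hs' e'] := absorbs_stab hk' ((hc (inr (l, ty (seg w 0 i), e))).1 ha).
by apply: stab_recog hL hs hs' _.
Qed.

End Merging.

(** * The game of a quantifier prefix and its winning strategies *)

Definition upl (a : letter) (p : AP) (b : bool) : letter :=
  fun q => if q == p then b else a q.

Fixpoint rg (qs : seq (quant * AP)) (a : letter) (K : letter -> Prop) : Prop :=
  match qs with
  | [::] => K a
  | (QuEx, p) :: qs' => exists b, rg qs' (upl a p b) K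
  | (QuAll, p) :: qs' => forall b, rg qs' (upl a p b) K
  end.

Fixpoint force qs (u : seq letter) (K : seq letter -> Prop) : Prop :=
  if u is a :: u' then rg qs a (fun a' => force qs u' (fun v => K (a' :: v)))
  else K [::].

(* Histories list the most recent letter first. *)
Fixpoint hist (w : word) t : seq letter := if t is t'.+1 then w t' :: hist w t' else [::].

(** A winning strategy of the existential player, given by the set [R] of histories it admits; it
    may leave several choices open. *)
Definition wintree qs (x : word) (W : word -> Prop) :=
  exists R : seq letter -> Prop, [/\ R [::],
    forall v, R v -> rg qs (x (size v)) (fun a => R (a :: v)) &
    forall w, (forall t, R (hist w t)) -> W w].

Lemma rg_mono qs a (K K' : letter -> Prop) :
  (forall a', K a' -> K' a') -> rg qs a K -> rg qs a K'.
Proof.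
move=> h; elim: qs a => [|[[] p] qs IH] a /=; first exact: h.
  by move=> [b hb]; exists b; apply: IH.
by move=> hb b; apply: IH.
Qed.

Lemma force_mono qs u (K K' : seq letter -> Prop) :
  (forall v, K v -> K' v) -> force qs u K -> force qs u K'.
Proof.
elim: u K K' => [|a u IH] K K' h /=; first exact: h.
by apply: rg_mono => a'; apply: IH => v; apply: h.
Qed.

Lemma force_cat qs u u' K :
  force qs (u ++ u') K <-> force qs u (fun v => force qs u' (fun v' => K (v ++ v'))).
Proof.
elim: u K => [|a u IH] K //=.
by split; apply: rg_mono => a'; move: (IH (fun v => K (a' :: v))) => [h1 h2].
Qed.

Lemma force_size qs u K : force qs u K -> force qs u (fun v => size v = size u /\ K v).
Proof.
elim: u K => [|a u IH] K //=; apply: rg_mono => a' /IH.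
by apply: force_mono => v [<-].
Qed.

Lemma size_hist w t : size (hist w t) = t.
Proof. by elim: t => //= t ->. Qed.

Lemma rev_hist w t : rev (hist w t) = seg w 0 t.
Proof. by elim: t => [|t IH] //=; rewrite rev_cons IH seg_rcons. Qed.

Section TransitionSystem.

Variables (qs : seq (quant * AP)) (x : word) (c : nat -> nat) (X : Type).
Variables (I : nat -> X -> Prop) (nxt : X -> seq letter -> X -> Prop) (x0 : X).
Variable W : word -> Prop.
Hypothesis cutc : cut c.
Hypothesis I0 : I 0 x0.

Definition good i s u := exists s', nxt s u s' /\ I i.+1 s'.

Hypothesis forceI : forall i s, I i s -> force qs (seg x (c i) (c i.+1)) (good i s).
Hypothesis winI : forall (w : word) (st : nat -> X), st 0 = x0 -> (forall i, I i (st i)) ->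
  (forall i, nxt (st i) (seg w (c i) (c i.+1)) (st i.+1)) -> W w.

(** Strategies for single blocks are strung together. The memory after a history holds the number of
    the present block, the state at its start and the letters read in it; [pick] selects the next
    state when the block is complete. *)
Lemma wintree_of_ts : wintree qs x W.
Proof.
have /choice[pick hpick] : forall p : nat * X * seq letter, exists s',
    good p.1.1 p.1.2 p.2 -> nxt p.1.2 p.2 s' /\ I p.1.1.+1 s'.
  move=> p; have [[s' h]|no] := pselect (good p.1.1 p.1.2 p.2); first by exists s'.
  by exists x0.
pose step a (m : nat * X * seq letter) n := let: (i, s, y) := m in
  if n == c i.+1 then (i.+1, pick (i, s, rcons y a), [::]) else (i, s, rcons y a).
pose fix mem v := if v is a :: v' then step a (mem v') (size v) else (0, x0, [::]).
pose J (m : nat * X * seq letter) n := let: (i, s, y) := m in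
  [/\ c i + size y = n, n < c i.+1, I i s &
      force qs (seg x n (c i.+1)) (fun z => good i s (y ++ z))].
pose V a (m : nat * X * seq letter) n := let: (i, s, y) := m in
  n = c i.+1 -> good i s (rcons y a).
(* [J] says that a good end of the present block can still be forced. [V] records that a block just
   completed was good, since the memory then drops its letters. *)
pose fix R v := J (mem v) (size v) /\
  if v is a :: v' then R v' /\ V a (mem v') (size v) else True.
have RJ v : R v -> J (mem v) (size v) by case: v => [|a v] [].
have Jstart i s : I i s -> J (i, s, [::]) (c i).
  by move=> hs; split=> //=; [rewrite addn0|exact: cutc.2|exact: forceI].
exists R; split.
- by split=> //; have := Jstart 0 x0 I0; rewrite cutc.1.
- move=> v hv; have /= := RJ v hv; case em : (mem v) => [[i s] y] [h1 h2 h3].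
  rewrite seg_cons //=; apply: rg_mono => a hf.
  have hg : (size v).+1 = c i.+1 -> good i s (rcons y a).
    by move=> e; move: hf; rewrite e segii /= cats1.
  split; last by split.
  case: eqP => [e|ne].
    by rewrite e; apply: Jstart; apply: (hpick (i, s, rcons y a) _).2; apply: hg.
  split=> //=; [by rewrite size_rcons; lia|lia|].
  by apply: force_mono hf => z; rewrite cat_rcons.
move=> w hR.
have memS t : mem (hist w t.+1) = step (w t) (mem (hist w t)) t.+1.
  by rewrite /= size_hist.
have inv t : exists i s, c i <= t < c i.+1 /\ mem (hist w t) = (i, s, seg w (c i) t).
  elim: t => [|t [i [s [ht em]]]].
    by exists 0, x0; rewrite cutc.1; split=> //; have := cutc.2 0; rewrite cutc.1.
  rewrite memS em /step; case: eqP => [e|ne].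
    exists i.+1, (pick (i, s, rcons (seg w (c i) t) (w t))); split.
      by have := cutc.2 i.+1; lia.
    by rewrite e segii.
  by exists i, s; split; [lia|rewrite seg_rcons //; lia].
pose st i := (mem (hist w (c i))).1.2.
have mst i k : c i + k < c i.+1 -> mem (hist w (c i + k)) = (i, st i, seg w (c i) (c i + k)).
  elim: k => [|k IH] lk.
    rewrite addn0 /st; have [j [s [hj ->]]] := inv (c i).
    have -> : j = i by apply: (cut_block_inj cutc hj); have := cutc.2 i; lia.
    by [].
  rewrite addnS memS IH; last lia.
  by rewrite /step ifF; [rewrite seg_rcons //; lia|lia].
have Ist i : I i (st i).
  have := RJ _ (hR (c i)); rewrite -{1}(addn0 (c i)) mst ?addn0; first by case.
  exact: cutc.2.
apply: (winI (st := st)) => //.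
  by rewrite /st cutc.1.
move=> i; have lt := cutc.2 i.
have e : c i.+1 = (c i + (c i.+1 - c i).-1).+1 by lia.
have em := @mst i (c i.+1 - c i).-1 ltac:(lia).
have := hR (c i.+1); rewrite {1}e => -[_] /=; rewrite em => -[_] /=.
rewrite size_hist -e => /(_ erefl) hg.
have [+ _] := hpick (i, st i, _) hg; rewrite /= -seg_rcons; last lia.
rewrite -e; congr nxt.
rewrite /st e memS em -e /= eqxx /=.
by rewrite -seg_rcons; [rewrite -e|lia].
Qed.

End TransitionSystem.

Lemma wintree_closed qs x W : wintree qs x W -> exists R : seq letter -> Prop,
  [/\ R [::], forall v, R v -> rg qs (x (size v)) (fun a => R (a :: v)),
    forall w, (forall t, R (hist w t)) -> W w & forall a v, R (a :: v) -> R v].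
Proof.
move=> [R [R0 RS RW]].
pose fix R' v := R v /\ if v is a :: v' then R' v' else True.
have R'R v : R' v -> R v by case: v => [|? ?] [].
exists R'; split=> //.
- by move=> v hv; apply: rg_mono (RS v (R'R v hv)) => a ha /=.
- by move=> w hw; apply: RW => t; apply: R'R.
by move=> a v [].
Qed.

Lemma tree_force qs x (R : seq letter -> Prop) v j :
  (forall v, R v -> rg qs (x (size v)) (fun a => R (a :: v))) ->
  R v -> size v <= j -> force qs (seg x (size v) j) (fun u => R (rev u ++ v)).
Proof.
move=> RS Rv lj; rewrite -(subnKC lj); move: (j - size v) => n {lj}.
elim: n v Rv => [|n IH] v Rv.
  by rewrite addn0 segii.
rewrite seg_cons /=; last lia.
apply: rg_mono (RS v Rv) => a /IH /=.
rewrite addSnnS; apply: force_mono => u.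
by rewrite rev_cons cat_rcons.
Qed.

(** The strategy on [x'] simulates a play on [x]: in each block it forces a type that the strategy
    on [x] admits for its own block, so the real and the simulated word have blocks of the same
    types. *)
Lemma wintree_transfer qs (T : finType) (ty : seq letter -> T) W x c x' c' :
  recog_by ty W -> cut c -> cut c' ->
  (forall i (S : {set T}), force qs (seg x (c i) (c i.+1)) (fun u => ty u \in S) ->
     force qs (seg x' (c' i) (c' i.+1)) (fun u => ty u \in S)) ->
  wintree qs x W -> wintree qs x' W.
Proof.
move=> hrec hc hc' hf /wintree_closed[R [R0 RS RW Rcl]].
pose I i v := R v /\ size v = c i.
pose nxt (v u' vn : seq letter) := exists2 u, ty u = ty u' & vn = rev u ++ v.
apply: (@wintree_of_ts qs x' c' (seq letter) I nxt [::]) => //.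
- by split=> //; rewrite hc.1.
- move=> i v [Rv sv]; have le : size v <= c i.+1 by have := hc.2 i; lia.
  have /force_size := tree_force RS Rv le; rewrite size_seg.
  pose S := [set t | `[< exists u, [/\ ty u = t, R (rev u ++ v) & size u = c i.+1 - size v] >]].
  move=> h; have {h} : force qs (seg x (c i) (c i.+1)) (fun u => ty u \in S).
    rewrite -sv; apply: force_mono h => u [su Ru]; rewrite inE; apply/asboolP.
    by exists u.
  move=> /hf; apply: force_mono => u'; rewrite inE => /asboolP[u [eu Ru su]].
  exists (rev u ++ v); split; first by exists u.
  by split=> //; rewrite size_cat size_rev; lia.
move=> w' st st0 hI hn.
have sst i : size (rev (st i)) = c i by rewrite size_rev; case: (hI i).
have /choice[u hu] : forall i, exists u, ty u = ty (seg w' (c' i) (c' i.+1)) /\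
    rev (st i.+1) = rev (st i) ++ u.
  by move=> i; have [u eu ->] := hn i; exists u; rewrite rev_cat revK.
pose d : letter := fun=> false.
(* The simulated word is the limit of the simulated histories. The default is never read: history
   number [t.+1] has length [c t.+1], which exceeds [t]. *)
pose w t := nth d (rev (st t.+1)) t.
have pre i j t : i <= j -> t < c i -> nth d (rev (st j)) t = nth d (rev (st i)) t.
  move=> ij lt; rewrite -(subnKC ij); elim: (j - i) => [|n <-]; rewrite ?addn0 //.
  rewrite addnS (hu _).2 nth_cat sst ifT //.
  by have := @cut_mono c i (i + n) hc; lia.
have segw i : seg w 0 (c i) = rev (st i).
  apply: (@eq_from_nth _ d); first by rewrite size_seg sst subn0.
  move=> t; rewrite size_seg subn0 => lt; rewrite (nth_map 0) ?size_iota ?subn0 //.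
  rewrite nth_iota // add0n /w; have := cut_ge t.+1 hc => ht.
  by have [le|ge] := leqP i t.+1; [rewrite (pre i)|rewrite (pre t.+1 i) //; lia].
have hst i : hist w (c i) = st i by apply: (can_inj revK); rewrite rev_hist segw.
have Ww : W w.
  apply: RW => t; have ht := cut_ge t hc.
  have : R (hist w (c t)) by rewrite hst; case: (hI t).
  rewrite -(subnKC ht); elim: (c t - t) => [|n IH]; rewrite ?addn0 // addnS /= => /Rcl.
  exact: IH.
apply: (hrec.2 w c w' c') Ww; split=> // i.
rewrite -(hu i).1; congr ty.
have := segw i.+1; rewrite (hu i).2 -(seg_cat _ (leq0n (c i)) (ltnW (hc.2 i))) segw.
by move/eqP; rewrite eqseq_cat // eqxx => /eqP.
Qed.

Lemma recog_wintree qs W : recog W -> recog (fun x => wintree qs x W).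
Proof.
move=> [T [ty hr]]; have h1 := hr.1.
pose gty u := [set S : {set T} | `[< force qs u (fun v => ty v \in S) >]].
have gE u u' (S : {set T}) : gty u = gty u' ->
    force qs u (fun v => ty v \in S) -> force qs u' (fun v => ty v \in S).
  by move=> e h; apply/asboolP; move/setP: e => /(_ S); rewrite !inE => <-; apply/asboolP.
(* Forcing [S] on [u ++ u'] amounts to forcing on [u] a type whose residual of [S] can be forced on
   [u']; only [gty u'] enters the set of these types. *)
have gcat u u' (S : {set T}) : force qs (u ++ u') (fun v => ty v \in S) <-> force qs u (fun v => ty v \in
    [set t | `[< exists v0, ty v0 = t /\
       [set t' | `[< exists v0', ty v0' = t' /\ ty (v0 ++ v0') \in S >]] \in gty u' >]]).
  have inS v0 v' : ty v' \in [set t' | `[< exists v0', ty v0' = t' /\ ty (v0 ++ v0') \in S >]]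
      <-> ty (v0 ++ v') \in S.
    rewrite inE; split=> [/asboolP[z [ez]]|h]; last by apply/asboolP; exists v'.
    by rewrite (h1 v0 v0 z v').
  rewrite force_cat; split; apply: force_mono => v.
    move=> h; rewrite inE; apply/asboolP; exists v; split=> //.
    by rewrite inE; apply/asboolP; apply: force_mono h => v' /inS.
  rewrite inE => /asboolP[v0 [e0]]; rewrite inE => /asboolP.
  by apply: force_mono => v' /inS; rewrite (h1 v0 v v' v').
have gC : congr_type gty.
  suff h u u' v v' : gty u = gty u' -> gty v = gty v' -> gty (u ++ v) \subset gty (u' ++ v').
    by move=> u u' v v' eu ev; apply/eqP; rewrite eqEsubset !h.
  move=> eu ev; apply/subsetP => S; rewrite !inE => /asboolP/gcat; rewrite ev => h.
  by apply/asboolP/gcat; apply: gE h.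
exists {set {set T}}, gty; split=> // x c x' c' [hc hc' e].
by apply: wintree_transfer hr hc hc' _ => i S; apply: gE; apply: e.
Qed.

(** * Determinacy of games with a Muller condition *)

Lemma dep_choice (A : Type) (Q : nat -> A -> Prop) (E : A -> A -> Prop) a0 :
  Q 0 a0 -> (forall n a, Q n a -> exists a', E a a' /\ Q n.+1 a') ->
  exists s, forall n, Q n (s n) /\ E (s n) (s n.+1).
Proof.
move=> h0 hS.
have /choice[g hg] : forall p : nat * A, exists a', Q p.1 p.2 -> E p.2 a' /\ Q p.1.+1 a'.
  move=> [n a]; have [/hS[a' h]|no] := pselect (Q n a); first by exists a'.
  by exists a0.
pose fix s n := if n is n'.+1 then g (n', s n') else a0.
have hs n : Q n (s n) by elim: n => //= n /(hg (n, _))[].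
by exists s => n; split=> //; have [] := hg (n, s n) (hs n).
Qed.

Section Games.

Variables (V : Type) (C : finType) (col : V -> {set C}) (Fam : {set C} -> Prop).

Definition infc (h : nat -> V) : {set C} := [set c | `[< infm (fun k => c \in col (h k)) >]].

Definition winning (P : bool) (D : {set C}) := if P then Fam D else ~ Fam D.

Lemma infc_shift k0 h : infc (fun k => h (k0 + k)) = infc h.
Proof.
apply/setP => c; rewrite !inE; apply: asbool_equiv_eq; split=> H N.
  by have [m Nm hm] := H N; exists (k0 + m) => //; lia.
have [m Nm hm] := H (k0 + N); exists (m - k0); first lia.
by rewrite subnKC //; lia.
Qed.

(* [f P u K]: at position [u], player [P] can force the next position into [K].
   Only the positions in [Z] belong to the game. *)
Record arena (f : bool -> V -> (V -> Prop) -> Prop) (Z : V -> Prop) := Arena {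
  ar_mono : forall P u (K K' : V -> Prop), (forall v, K v -> K' v) -> f P u K -> f P u K';
  ar_dual : forall P u K, ~ f P u K -> f (~~ P) u (fun v => ~ K v);
  ar_loc : forall P u K, Z u -> f P u K -> f P u (fun v => K v /\ Z v) }.

(* A strategy with memory: [ts_x] is the set of memory states, of which only those in [ts_I]
   are used, and [ts_nxt] the nondeterministic update. *)
Record ts (f : bool -> V -> (V -> Prop) -> Prop) (P : bool) (v : V) := TS {
  ts_x : Type;
  ts_pos : ts_x -> V;
  ts_I : ts_x -> Prop;
  ts_nxt : ts_x -> ts_x -> Prop;
  ts_0 : ts_x;
  ts_pos0 : ts_pos ts_0 = v;
  ts_I0 : ts_I ts_0;
  ts_step : forall x, ts_I x -> f P (ts_pos x)
    (fun v' => exists x', [/\ ts_nxt x x', ts_I x' & ts_pos x' = v']);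
  ts_win : forall r, (forall k, ts_I (r k)) -> (forall k, ts_nxt (r k) (r k.+1)) ->
    winning P (infc (fun k => ts_pos (r k))) }.

Definition wins f P v := inhabited (ts f P v).

Lemma wins_in f Z P v : arena f Z -> Z v -> wins f P v ->
  exists S : ts f P v, forall x, ts_I (t := S) x -> Z (ts_pos x).
Proof.
move=> ar Zv [S]; unshelve eexists (@TS f P v (ts_x S) (@ts_pos _ _ _ S)
  (fun x => ts_I x /\ Z (ts_pos x)) (@ts_nxt _ _ _ S) (ts_0 S) _ _ _ _).
- exact: ts_pos0.
- by split; [exact: ts_I0|rewrite ts_pos0].
- move=> x [Ix Zx]; apply: (ar_mono ar _ (ar_loc ar Zx (ts_step Ix))) => v' [[x' [h1 h2 h3]] Zv'].
  by exists x'; split=> //; split=> //; rewrite h3.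
- by move=> r hI hn; apply: ts_win => // k; case: (hI k).
by move=> x [].
Qed.

Section Glue.

Variables (f : bool -> V -> (V -> Prop) -> Prop) (Z : V -> Prop) (P : bool).
Hypothesis ar : arena f Z.
Variables (X : Type) (pos : X -> V) (I : X -> Prop) (nxt : X -> X -> Prop).
Hypothesis stepX : forall x, I x -> f P (pos x)
  (fun v' => (exists x', [/\ nxt x x', I x' & pos x' = v']) \/ wins f P v').
Hypothesis winX : forall r, (forall k, I (r k)) -> (forall k, nxt (r k) (r k.+1)) ->
  winning P (infc (fun k => pos (r k))).

Definition gdata w (h : wins f P w) : ts f P w := inhabited_witness h.

Inductive gstate :=
| GL of X
| GR w (h : wins f P w) of ts_x (gdata h).

Definition gpos s := match s with GL x => pos x | GR _ _ y => ts_pos y end.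
Definition gI s := match s with GL x => I x | GR _ _ y => ts_I y end.
Definition gnxt s s' :=
  match s with
  | GL x => (exists2 x', s' = GL x' & nxt x x') \/ exists w (h : wins f P w), s' = GR (ts_0 (gdata h))
  | GR _ h y => exists2 y', s' = @GR _ h y' & ts_nxt y y'
  end.

(** After a move into a won position the play follows a strategy from there. The winning condition
    ignores finite prefixes, so such a play is won; one that never switches is won by [winX]. *)
Lemma wins_glue x : I x -> wins f P (pos x).
Proof.
move=> Ix; constructor.
apply: (@TS f P (pos x) gstate gpos gI gnxt (GL x)) => //.
  case=> [{Ix}x Ix|w h y Iy] /=.
    apply: (ar_mono ar _ (stepX Ix)) => v' [[x' [h1 h2 h3]]|hw].
      by exists (GL x'); split=> //; left; exists x'.
    exists (GR (ts_0 (gdata hw))); split=> /=; [|exact: ts_I0|exact: ts_pos0].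
    by right; exists v', hw.
  apply: (ar_mono ar _ (ts_step Iy)) => v' [y' [h1 h2 h3]].
  by exists (GR y'); split=> //; exists y'.
move=> r rI rn.
have [[k0 [w [h [y ek]]]]|no] := pselect (exists k w h y, r k = @GR w h y).
  have [||s hs] := @dep_choice _ (fun n y => r (k0 + n) = GR y) (@ts_nxt _ _ _ (gdata h)) y.
  - by rewrite addn0.
  - move=> n z ez; have := rn (k0 + n); rewrite ez -addnS => -[z' ez' hz].
    by exists z'.
  rewrite -(infc_shift k0); have -> : (fun k => gpos (r (k0 + k))) = fun k => ts_pos (s k).
    by apply: funext => k; rewrite (hs k).1.
  apply: ts_win => k; last exact: (hs k).2.
  by have := rI (k0 + k); rewrite (hs k).1.
have /choice[s hs] : forall k, exists x, r k = GL x.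
  move=> k; case e : (r k) => [x'|w h y]; first by exists x'.
  by case: no; exists k, w, h, y.
have -> : (fun k => gpos (r k)) = fun k => pos (s k) by apply: funext => k; rewrite hs.
apply: winX => k; first by have := rI k; rewrite hs.
have := rn k; rewrite !hs => -[[x' [->]] //|[w [h]]].
by [].
Qed.

End Glue.

Lemma wins_step f Z P u : arena f Z -> f P u (wins f P) -> wins f P u.
Proof.
move=> ar h; apply: (@wins_glue f Z P ar unit (fun=> u) (fun=> True) (fun _ _ => False)) tt _ => //.
- by move=> _ _; apply: (ar_mono ar _ h) => v hv; right.
by move=> r _ /(_ 0).
Qed.

Section Step.

Variables (f : bool -> V -> (V -> Prop) -> Prop) (Z : V -> Prop) (P : bool) (D : {set C}).
Hypothesis ar : arena f Z.
Hypothesis colD : forall u, Z u -> col u \subset D.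
Hypothesis winD : winning P D.

(** Here [P] is the player who wins when exactly the colours of [D] recur. Determinacy follows once
    [P] is shown to win from every position that the opponent does not win. *)
Definition safe u := Z u /\ ~ wins f (~~ P) u.

Lemma safe_force u : safe u -> f P u safe.
Proof.
move=> [Zu nw]; apply: contrapT => /(ar_dual ar) /(ar_loc ar Zu) h; apply: nw.
apply: (wins_step ar); apply: (ar_mono ar _ h) => v [nv Zv].
by apply: contrapT => nw; apply: nv.
Qed.

Fixpoint attr (c : C) n u := c \in col u \/
  if n is n'.+1 then f P u (fun v => safe v /\ attr c n' v) else False.

Definition avoid c u := safe u /\ forall n, ~ attr c n u.

(** Leaving [avoid c] while staying safe is a success for [P], leaving the safe positions is one for
    the opponent; so play continues only within [avoid c], where colour [c] does not occur. *)
Definition subgame c (R : bool) u (K : V -> Prop) :=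
  f R u (fun v => if R == P then safe v /\ (avoid c v -> K v) else safe v -> avoid c v /\ K v).

Lemma subgame_arena c : arena (subgame c) (avoid c).
Proof.
split.
- move=> R u K K' h; apply: (ar_mono ar) => v; case: eqP => _.
    by move=> [a b]; split=> // /b /h.
  by move=> h' /h'[a /h].
- move=> R u K /(ar_dual ar); apply: (ar_mono ar) => v.
  have -> : (~~ R == P) = ~~ (R == P) by case: (R); case: (P).
  case: eqP => _ /= hn.
    by move=> sv; split; [|move=> Kv]; apply: contrapT => h'; apply: hn; split=> //; tauto.
  have sv : safe v by apply: contrapT; tauto.
  by split=> // av Kv; apply: hn.
move=> R u K av; apply: (ar_mono ar) => v; case: eqP => _.
  by move=> [sv h]; split=> // a; split=> //; apply: h.
by move=> h /h[a k].
Qed.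

(** A winning strategy of the opponent in the subgame, continued by one from the unsafe position
    reached at an exit, would win the whole game although [u] is safe. *)
Lemma subgame_opponent c u : avoid c u -> ~ wins (subgame c) (~~ P) u.
Proof.
move=> au /(wins_in (subgame_arena c) au)[S hS]; apply: au.1.2.
rewrite -(ts_pos0 S).
apply: (@wins_glue f Z (~~ P) ar _ (@ts_pos _ _ _ S) (@ts_I _ _ _ S) (@ts_nxt _ _ _ S)) _ _ _ (ts_I0 S).
  move=> x Ix; have Zx : Z (ts_pos x) by case: (hS x Ix) => [[]].
  apply: (ar_mono ar _ (ar_loc ar Zx (ts_step Ix))) => v [].
  have -> : (~~ P == P) = false by case: (P).
  move=> h Zv; have [/h[_ hx]|ns] := pselect (safe v); first by left.
  by right; apply: contrapT => nw; apply: ns.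
by move=> r rI rn; apply: ts_win.
Qed.

Hypothesis IH : forall c, c \in D -> forall u, avoid c u ->
  wins (subgame c) P u \/ wins (subgame c) (~~ P) u.

Lemma avoid_wins c u : c \in D -> avoid c u -> wins (subgame c) P u.
Proof. by move=> cD au; have [//|/(subgame_opponent au)] := IH cD au. Qed.

Section Cycle.

Variable c0 : C.
Hypothesis c0D : c0 \in D.

(** The targets run cyclically through [D]. *)
Definition tgt j := nth c0 (enum D) (j %% #|D|).

Lemma card_D : 0 < #|D|.
Proof. by apply/card_gt0P; exists c0. Qed.

Lemma tgtD j : tgt j \in D.
Proof. by rewrite -mem_enum mem_nth // -cardE ltn_mod card_D. Qed.

Lemma tgt_onto c J : c \in D -> exists2 j, J <= j & tgt j = c.
Proof.
move=> cD; exists (J * #|D| + index c (enum D)).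
  by apply: leq_trans (leq_addr _ _); rewrite leq_pmulr // card_D.
by rewrite /tgt modnMDl modn_small ?nth_index ?mem_enum // cardE index_mem mem_enum.
Qed.

Definition sdata j u (au : avoid (tgt j) u) := cid
  (wins_in (subgame_arena (tgt j)) au (avoid_wins (tgtD j) au)).

(** With target number [j], [SA] heads for the target colour, at most [n] moves away, and [SM]
    follows a strategy of the subgame that avoids it. Visiting the target advances [j]. *)
Inductive cstate :=
| SA of nat & nat & V
| SM j u (au : avoid (tgt j) u) of ts_x (sval (sdata au)).

Definition cpos s := match s with SA _ _ u => u | SM _ _ _ y => ts_pos y end.
Definition cI s := match s with
  | SA j n u => safe u /\ attr (tgt j) n u
  | SM _ _ _ y => ts_I y end.
Definition cidx s := match s with SA j _ _ => j | SM j _ _ _ => j end.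

Definition entry j s := (exists n u, s = SA j n u) \/
  exists u (au : avoid (tgt j) u), s = SM (ts_0 (sval (sdata au))).

Definition cnxt s s' := match s with
  | SA j n u => if tgt j \in col u then entry j.+1 s' else
      exists n' u', n = n'.+1 /\ s' = SA j n' u'
  | SM j _ au y => (exists n u', s' = SA j n u') \/
      exists2 y', s' = @SM j _ au y' & ts_nxt y y'
  end.

Lemma entry_ex j u : safe u -> exists s, [/\ entry j s, cI s & cpos s = u].
Proof.
move=> su; have [[n an]|na] := pselect (exists n, attr (tgt j) n u).
  by exists (SA j n u); split=> //; left; exists n, u.
have au : avoid (tgt j) u by split=> // n an; apply: na; exists n.
exists (SM (ts_0 (sval (sdata au)))); split=> /=; [|exact: ts_I0|exact: ts_pos0].
by right; exists u, au.
Qed.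

Lemma cstep s : cI s -> f P (cpos s) (fun v => exists s', [/\ cnxt s s', cI s' & cpos s' = v]).
Proof.
case: s => [j n u|j u au y] /=.
  move=> [su an]; case hc : (tgt j \in col u).
    by apply: (ar_mono ar _ (safe_force su)) => v /(entry_ex j.+1).
  case: n an => [|n] /= [h|h]; try by [rewrite hc in h|case: h].
  apply: (ar_mono ar _ h) => v [sv av]; exists (SA j n v); split=> //.
  by exists n, v.
move=> Iy; apply: (ar_mono ar _ (ts_step Iy)) => v; rewrite eqxx => -[sv h].
have [av|na] := pselect (avoid (tgt j) v).
  have [y' [h1 h2 h3]] := h av; exists (SM y'); split=> //.
  by right; exists y'.
have [n an] : exists n, attr (tgt j) n v.
  by apply: contrapT => no; apply: na; split=> // n an; apply: no; exists n.
by exists (SA j n v); split=> //; left; exists n, v.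
Qed.

Lemma csafe s : cI s -> safe (cpos s).
Proof. by case: s => [j n u []|j u au y] //= /(svalP (sdata au))[]. Qed.

Lemma cidx_step s s' : cnxt s s' -> cidx s' = cidx s \/
  [/\ cidx s' = (cidx s).+1 & tgt (cidx s) \in col (cpos s)].
Proof.
case: s => [j n u|j u au y] /=; last by move=> [[n [u' ->]]|[y' ->]]; left.
case: ifP => hc; last by move=> [n' [u' [_ ->]]]; left.
by move=> [[n' [u' ->]]|[u' [au' ->]]]; right.
Qed.

Lemma cidx_entry j s : entry j s -> cidx s = j.
Proof. by case=> [[n [u ->]]|[u [au ->]]]. Qed.

Lemma cwin r : (forall k, cI (r k)) -> (forall k, cnxt (r k) (r k.+1)) ->
  winning P (infc (fun k => cpos (r k))).
Proof.
move=> rI rn.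
have idm a b : a <= b -> cidx (r a) <= cidx (r b).
  move=> ab; rewrite -(subnKC ab); elim: (b - a) => [|n IH']; rewrite ?addn0 ?addnS //.
  by have [->|[-> _]] := cidx_step (rn (a + n)); lia.
have [unb|bnd] := pselect (forall J, exists k, J <= cidx (r k)).
  (* If the targets advance forever, every colour of [D] recurs and [winD] applies. *)
  suff -> : infc (fun k => cpos (r k)) = D by [].
  apply/eqP; rewrite eqEsubset; apply/andP; split; apply/subsetP => c.
    rewrite inE => /asboolP /(_ 0)[k _]; apply: (subsetP (colD _)).
    by have [] := csafe (rI k).
  move=> cD; rewrite inE; apply/asboolP => K.
  have [j hj ec] := tgt_onto (cidx (r K)) cD.
  have ex : exists k, j < cidx (r k) by have [k] := unb j.+1; exists k.
  case: (ex_minnP ex) => -[|k] hk kmin.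
    by have := idm 0 K (leq0n K); lia.
  have Kk : K <= k.
    by rewrite leqNgt; apply/negP => lt; have := idm _ _ lt; lia.
  have lek : cidx (r k) <= j.
    by rewrite leqNgt; apply/negP => /kmin; lia.
  have [e|[e hc]] := cidx_step (rn k); first by lia.
  exists k => //; have ej : cidx (r k) = j by lia.
  by rewrite -ec -ej.
have [J hJ] : exists J, forall k, cidx (r k) < J.
  apply: contrapT => no; apply: bnd => J; apply: contrapT => h; apply: no; exists J => k.
  by rewrite ltnNge; apply/negP => h'; apply: h; exists k.
have exP : exists j, `[< exists k, cidx (r k) = j >].
  by exists (cidx (r 0)); apply/asboolP; exists 0.
have bdP j : `[< exists k, cidx (r k) = j >] -> j <= J.
  by move=> /asboolP[k <-]; apply: ltnW.
case: (ex_maxnP exP bdP) => j /asboolP[k0 ek0] jmax.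
have cst k : k0 <= k -> cidx (r k) = j.
  move=> hk; have := idm _ _ hk; have : cidx (r k) <= j by apply: jmax; apply/asboolP; exists k.
  lia.
(* After the last change of target no attractor state occurs: its counter would run down to a visit
   of the target. The play thus follows a single subgame strategy. *)
have noSA n : forall k u j', k0 <= k -> r k <> SA j' n u.
  elim: n => [|n IHn] k u j' hk e; have := rn k; have := cst _ (leqW hk);
    have := cst _ hk; rewrite e /= => e1 e2; case: ifP => hc.
  - by move=> /cidx_entry; lia.
  - by move=> [n' [u' []]].
  - by move=> /cidx_entry; lia.
  - by move=> [n' [u' [[<-] e']]]; apply: IHn (leqW hk) e'.
have [j' [u [au [y ey]]]] : exists j' u au y, r k0 = @SM j' u au y.
  case e : (r k0) => [j' n u|j' u au y]; first by have := noSA n k0 u j' (leqnn _).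
  by exists j', u, au, y.
have [||s hs] := @dep_choice _ (fun n y => r (k0 + n) = SM y) (@ts_nxt _ _ _ (sval (sdata au))) y.
- by rewrite addn0.
- move=> n z ez; have := rn (k0 + n); rewrite ez -addnS => -[[n' [u' e]]|[z' ez' hz]].
    by have := noSA n' (k0 + n.+1) u' j' (leq_addr _ _).
  by exists z'.
rewrite -(infc_shift k0); have -> : (fun k => cpos (r (k0 + k))) = fun k => ts_pos (s k).
  by apply: funext => k; rewrite (hs k).1.
apply: ts_win => k; last exact: (hs k).2.
by have := rI (k0 + k); rewrite (hs k).1.
Qed.

Lemma safe_wins_cycle u : safe u -> wins f P u.
Proof.
move=> /(entry_ex 0)[s [_ Is <-]]; constructor.
by apply: (@TS f P (cpos s) cstate cpos cI cnxt s) => //; [exact: cstep|exact: cwin].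
Qed.

End Cycle.

Lemma safe_wins u : safe u -> wins f P u.
Proof.
(* Without colours there is no target; staying safe is enough, as no colour recurs. *)
have [D0|[c cD]] := set_0Vmem D; last exact: (safe_wins_cycle cD).
move=> su; constructor.
apply: (@TS f P u V id safe (fun _ _ => True) u) => //.
  by move=> x /safe_force; apply: (ar_mono ar) => v sv; exists v.
move=> r rI _; suff -> : infc (fun k => id (r k)) = D by [].
apply/setP => c; rewrite D0 !inE; apply/asboolP => /(_ 0)[k _].
by have /subsetP/(_ c) := colD (rI k).1; rewrite D0 inE => h /h.
Qed.

End Step.

(** Colour [c] is absent from its subgame, so the induction hypothesis applies there with
    [D :\ c]. *)
Theorem determined n (D : {set C}) f Z : #|D| <= n -> arena f Z ->
  (forall u, Z u -> col u \subset D) -> forall u, Z u -> wins f true u \/ wins f false u.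
Proof.
elim: n D f Z => [|n IH] D f Z cD ar colD u Zu.
all: have [P winD] : exists P, winning P D.
all: try by have [h|h] := pselect (Fam D); [exists true|exists false].
all: suff : wins f P u \/ wins f (~~ P) u by case: (P) => /=; tauto.
all: have [?|nw] := pselect (wins f (~~ P) u); [by right|left].
all: apply: (safe_wins ar colD winD _ (conj Zu nw)) => c cinD v av.
  by move: cD; rewrite leqn0 cards_eq0 => /eqP e; move: cinD; rewrite e inE.
have : wins (subgame f Z P c) true v \/ wins (subgame f Z P c) false v.
  apply: (IH (D :\ c) _ (avoid f Z P c)) => //.
  - by have := cardsD1 c D; rewrite cinD; lia.
  - exact: subgame_arena.
  move=> w [[Zw _] na]; apply/subsetP => d dw; rewrite !inE (subsetP (colD w Zw)) // andbT.
  by apply/eqP => e; apply: (na 0); left; rewrite -e.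
by case: (P) => /=; tauto.
Qed.

End Games.

(** * Determinacy of the game of a quantifier prefix *)

Definition dualq (qs : seq (quant * AP)) : seq (quant * AP) :=
  [seq (if p.1 is QuEx then QuAll else QuEx, p.2) | p <- qs].

Lemma rg_dual qs a (K : letter -> Prop) : ~ rg qs a K -> rg (dualq qs) a (fun v => ~ K v).
Proof.
elim: qs a => [|[[] p] qs IH] a //= h.
  by move=> b; apply: IH => hb; apply: h; exists b.
apply: contrapT => no; apply: h => b; apply: contrapT => hb; apply: no.
by exists b; apply: IH.
Qed.

Lemma dualqK : involutive dualq.
Proof. by move=> qs; rewrite /dualq -map_comp -[RHS]map_id; apply: eq_map => -[[] p]. Qed.

Lemma wintree_of_wins qs x (C : finType) (col : seq letter -> {set C}) Fam
    (f : bool -> seq letter -> (seq letter -> Prop) -> Prop) P (W : word -> Prop) :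
  (forall u K, f P u K = rg qs (x (size u)) (fun a => K (a :: u))) ->
  (forall w, winning Fam P (infc col (hist w)) -> W w) ->
  wins col Fam f P [::] -> wintree qs x W.
Proof.
move=> fE hW [S].
pose I i (s : ts_x S) := ts_I s /\ size (ts_pos s) = i.
pose nxt (s : ts_x S) u s' := exists a, [/\ u = [:: a], ts_nxt s s' & ts_pos s' = a :: ts_pos s].
apply: (@wintree_of_ts qs x id (ts_x S) I nxt (ts_0 S)) => //.
- by split; [exact: ts_I0|rewrite ts_pos0].
- move=> i s [Is <-]; rewrite seg1 /=; have := ts_step Is; rewrite fE.
  apply: rg_mono => a [s' [h1 h2 h3]]; exists s'; split; first by exists a.
  by split=> //; rewrite h3.
move=> w st st0 hI hn; apply: hW.
have -> : hist w = fun k => ts_pos (st k).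
  apply: funext; elim=> [|k IH]; first by rewrite st0 ts_pos0.
  by have [a [+ _ ->]] := hn k; rewrite seg1 /= IH => -[->].
by apply: ts_win => k; [case: (hI k)|have [a []] := hn k].
Qed.

Theorem wintree_determined qs x W : recog W ->
  wintree qs x W \/ wintree (dualq qs) x (fun w => ~ W w).
Proof.
move=> [T [ty hr]].
pose col (v : seq letter) := [set c | `[< event ty (rev v) c >]].
(* By [event_recog], words with the same recurring colours are all in [W] or all outside, so [Fam]
   expresses [W]. *)
pose Fam D := exists2 w, W w & infc col (hist w) = D.
pose f (R : bool) u (K : seq letter -> Prop) :=
  rg (if R then qs else dualq qs) (x (size u)) (fun a => K (a :: u)).
have FamW w : Fam (infc col (hist w)) <-> W w.
  split=> [[w' Ww' e]|Ww]; last by exists w.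
  apply: (event_recog hr.1 hr) Ww' => c; move/setP: e => /(_ c); rewrite !inE.
  have E w0 : infm (fun k => c \in col (hist w0 k)) <-> infm (fun k => event ty (seg w0 0 k) c).
    by split; apply: infm_sub => m; rewrite inE rev_hist => /asboolP.
  by move=> e; rewrite -!E; split=> /asboolP h; apply/asboolP; [rewrite -e|rewrite e].
have ar : arena f (fun=> True).
  split.
  - by move=> P u K K' h; apply: rg_mono => a; apply: h.
  - by move=> P u K /rg_dual; rewrite /f; case: P; rewrite ?dualqK.
  - by move=> P u K _; apply: rg_mono.
have [||h|h] := @determined _ _ col Fam _ setT f (fun=> True) (leqnn _) ar _ [::].
- by move=> u _; apply: subsetT.
- by [].
- by left; apply: (wintree_of_wins _ _ h) => // w /FamW.
by right; apply: (wintree_of_wins _ _ h) => // w nF /FamW.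
Qed.

(** * Causal functors and elimination of the last quantifier *)

Definition colset (w : word) p (f : tval) : word := fun t => upl (w t) p (f t).

(* The values of a causal functor, which reads the letters up to and including the present one. *)
Definition causal (beta : seq letter -> letter -> bool) (w : word) : tval :=
  fun t => beta (hist w t) (w t).

Lemma aval_upd chi p f : aval (upd chi p f) = colset (aval chi) p f.
Proof.
apply: funext => t; apply: funext => q; rewrite /aval /upd /colset /upl.
by case: (PeanoNat.Nat.eqb_spec q p) => [->|/eqP/negbTE ->]; rewrite ?eqxx.
Qed.

Lemma rg_rcons qs Q p a K : rg (rcons qs (Q, p)) a K <->
  rg qs a (fun a' => rg [:: (Q, p)] a' K).
Proof.
elim: qs a => [|[[] q] qs IH] a //=.
  by split=> -[b /IH hb]; exists b.
by split=> hb b; apply/IH.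
Qed.

Fixpoint lift p (beta : seq letter -> letter -> bool) (v : seq letter) : seq letter :=
  if v is a :: v' then upl a p (beta v' a) :: lift p beta v' else [::].

Lemma size_lift p beta v : size (lift p beta v) = size v.
Proof. by elim: v => //= a v ->. Qed.

Lemma lift_hist p beta w t : lift p beta (hist w t) = hist (colset w p (causal beta w)) t.
Proof. by elim: t => //= t ->. Qed.

Lemma wintree_lift qs x p beta (R : seq letter -> Prop) (W : word -> Prop) : R [::] ->
  (forall v, R (lift p beta v) ->
     rg qs (x (size v)) (fun a => R (upl a p (beta v a) :: lift p beta v))) ->
  (forall w, (forall t, R (hist w t)) -> W w) ->
  wintree qs x (fun w => W (colset w p (causal beta w))).
Proof.
move=> R0 RS RW; exists (fun v => R (lift p beta v)); split=> // w hw.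
by apply: RW => t; rewrite -lift_hist.
Qed.

(** The last quantifier of the prefix moves last in each round, so its value is a function of the
    history and of the letter built so far. *)
Lemma wintree_ex qs x p W : wintree (rcons qs (QuEx, p)) x W ->
  exists beta, wintree qs x (fun w => W (colset w p (causal beta w))).
Proof.
move=> [R [R0 RS RW]].
have /choice[pick hpick] : forall va : seq letter * letter, exists b,
    (exists b, R (upl va.2 p b :: va.1)) -> R (upl va.2 p b :: va.1).
  move=> va; have [[b h]|no] := pselect (exists b, R (upl va.2 p b :: va.1)).
    by exists b.
  by exists true.
(* The choice depends on the history with column [p] already filled in, so that history is built
   first; [liftE] then identifies it with [lift p beta]. *)
pose fix liftR v := if v is a :: v' then upl a p (pick (liftR v', a)) :: liftR v' else [::].
pose beta v a := pick (liftR v, a).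
have liftE v : lift p beta v = liftR v by elim: v => //= a v ->.
exists beta; apply: wintree_lift R0 _ RW => v; rewrite liftE => Rv.
have := RS _ Rv; rewrite -liftE size_lift => /rg_rcons.
by apply: rg_mono => a hb; rewrite liftE in hb *; apply: (hpick (_, _)).
Qed.

(** The strategy withstands both values of [p] in each round, in particular the one given by
    [beta]. *)
Lemma wintree_all qs x p beta W : wintree (rcons qs (QuAll, p)) x W ->
  wintree qs x (fun w => W (colset w p (causal beta w))).
Proof.
move=> [R [R0 RS RW]]; apply: wintree_lift R0 _ RW => v Rv.
have := RS _ Rv; rewrite size_lift => /rg_rcons.
by apply: rg_mono => a; apply.
Qed.

Lemma wintree_nil x W : wintree [::] x W -> W x.
Proof.
move=> [R [R0 RS RW]]; apply: RW; elim=> //= t /RS /=.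
by rewrite size_hist.
Qed.

(** * Behavioral functors and the semantics on hyperassignments *)

Definition finite_ap (P : apset) := exists s : seq AP, forall q, P q -> q \in s.

Lemma finite_add P p : finite_ap P -> finite_ap (add_ap P p).
Proof.
by move=> [s hs]; exists (p :: s) => q [/hs h|->]; rewrite inE ?eqxx // h orbT.
Qed.

Lemma dom_upd P p chi f : asg_dom chi P -> asg_dom (upd chi p f) (add_ap P p).
Proof.
move=> h q; rewrite /upd /add_ap; case: (PeanoNat.Nat.eqb_spec q p) => e.
  by split=> // _; right.
by rewrite h; split=> [[//|/e]//|]; left.
Qed.

(** The behavioral condition compares assignments that differ in one proposition. As the domain is
    finite, the assignments [mix] lead from [c1] to [c2] by changing one proposition at a time. *)
Lemma behavioral_causal P F c1 c2 k : finite_ap P -> behavioral P F ->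
  asg_dom c1 P -> asg_dom c2 P ->
  (forall q t, P q -> t <= k -> aval c1 t q = aval c2 t q) -> F c1 k = F c2 k.
Proof.
move=> [s hs] hF d1 d2 e.
pose mix (s : seq AP) : asg := fun q => if q \in s then c2 q else c1 q.
have dmix s' : asg_dom (mix s') P by move=> q; rewrite /mix; case: ifP.
have none q : ~ P q -> c1 q = c2 q.
  move=> nP; case e1 : (c1 q) => [f|]; first by case: nP; apply/d1; rewrite e1.
  by case e2 : (c2 q) => [f|] //; case: nP; apply/d2; rewrite e2.
have step s' : F c1 k = F (mix s') k.
  elim: s' => [//|q s' ->]; have [Pq|nP] := pselect (P q).
    apply: (hF q Pq) => //; split.
      by move=> q' _ ne; rewrite /mix inE; case: eqP.
    move=> t /leP lt; rewrite /aval /mix inE eqxx /=.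
    by case: ifP => // _; apply: e.
  congr (F _ k); apply: funext => q'; rewrite /mix inE.
  by case: eqP => //= ->; rewrite none //; case: ifP.
rewrite (step s); congr (F _ k); apply: funext => q; rewrite /mix.
by case: ifP => // hq; apply: none => /hs; rewrite hq.
Qed.

Definition pay (fl : flag) (X : hyper) (T : asg -> Prop) : Prop :=
  match fl with
  | FEA => exists S, X S /\ forall chi, S chi -> T chi
  | FAE => forall S, X S -> exists chi, S chi /\ T chi
  end.

(** The image of a choice function lies inside [T] exactly when the function picks a witness of [T]
    from every set. *)
Lemma pay_dual_EA X T : pay FEA (dual X) T <-> pay FAE X T.
Proof.
split=> [[Y [[c [hc hY]] hT]] S XS|h].
  by exists (c S); split; [exact: hc|apply: hT; apply/hY; exists S].
have /choice[c hc] : forall S, exists chi : asg, X S -> S chi /\ T chi.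
  move=> S; have [XS|no] := pselect (X S); first by have [chi] := h S XS; exists chi.
  by exists (fun=> None).
exists (fun a => exists S, X S /\ a = c S); split.
  by exists c; split=> // S /hc[].
by move=> chi [S [/hc[_ h'] ->]].
Qed.

(** If no set lies inside [T], a choice function that picks counterexamples has an image missing
    [T]. *)
Lemma pay_dual_AE X T : pay FAE (dual X) T <-> pay FEA X T.
Proof.
split=> [h|[S [XS hT]] Y [c [hc hY]]].
  apply: contrapT => no.
  have /choice[c hc] : forall S, exists chi : asg, X S -> S chi /\ ~ T chi.
    move=> S; have [XS|nX] := pselect (X S); last by exists (fun=> None).
    apply: contrapT => h'; apply: no; exists S; split=> // chi Sc.
    by apply: contrapT => nT; apply: h'; exists chi.
  have [|chi [[S [XS ->]]]] := h (fun a => exists S, X S /\ a = c S).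
    by exists c; split=> // S /hc[].
  by case: (hc S XS).
by exists (c S); split; [apply/hY; exists S|apply: hT; apply: hc].
Qed.

Lemma pay_ext_EA P X p T : pay FEA (extB P X p) T <->
  exists F, behavioral P F /\ pay FEA X (fun chi => T (upd chi p (F chi))).
Proof.
split=> [[Y [[S [F [XS [hF hY]]]] hT]]|[F [hF [S [XS hT]]]]].
  exists F; split=> //; exists S; split=> // chi Sc.
  by apply: hT; apply/hY; exists chi.
exists (ext S F p); split; first by exists S, F.
by move=> chi [chi' [/hT h ->]].
Qed.

Lemma pay_ext_AE P X p T : pay FAE (extB P X p) T <->
  forall F, behavioral P F -> pay FAE X (fun chi => T (upd chi p (F chi))).
Proof.
split=> [h F hF S XS|h Y [S [F [XS [hF hY]]]]].
  have [|chi [[chi' [Sc ->]] hT]] := h (ext S F p); first by exists S, F.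
  by exists chi'.
have [chi [Sc hT]] := h F hF S XS.
by exists (upd chi p (F chi)); split=> //; apply/hY; exists chi.
Qed.

(* Quantification over functors, the last quantifier of the prefix being the outermost one;
   [U] evaluates the quantifiers that were already read. *)
Fixpoint functor_sat (P : apset) (qs : seq (quant * AP)) (psi : ltl)
    (U : (asg -> Prop) -> Prop) : Prop :=
  match qs with
  | [::] => U (fun chi => ltl_sat chi psi)
  | (QuEx, p) :: qs' => functor_sat (add_ap P p) qs' psi
      (fun T => exists F, behavioral P F /\ U (fun chi => T (upd chi p (F chi))))
  | (QuAll, p) :: qs' => functor_sat (add_ap P p) qs' psi
      (fun T => forall F, behavioral P F -> U (fun chi => T (upd chi p (F chi))))
  end.

(** Only the evaluation [U] of a hyperassignment matters: dualizing together with a change of flag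
    preserves it, and an extension puts the quantifier over the new functor in front of it. *)
Lemma gsat_pre_functor P qs psi fl X U : (forall T, U T <-> pay fl X T) ->
  gsat_pre P qs psi fl X <-> functor_sat P qs psi U.
Proof.
elim: qs P fl X U => [|[[] p] qs IH] P fl X U hU /=.
- by rewrite hU; case: fl {hU}.
- have h Y : (forall T, U T <-> pay FEA Y T) ->
    gsat_pre (add_ap P p) qs psi FEA (extB P Y p) <-> functor_sat (add_ap P p) qs psi
      (fun T => exists F, behavioral P F /\ U (fun chi => T (upd chi p (F chi)))).
    move=> hY; apply: IH => T; rewrite pay_ext_EA.
    by split=> -[F [hF /hY hp]]; exists F.
  by case: fl hU => hU; apply: h => // T; rewrite hU pay_dual_EA.
have h Y : (forall T, U T <-> pay FAE Y T) ->
    gsat_pre (add_ap P p) qs psi FAE (extB P Y p) <-> functor_sat (add_ap P p) qs psi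
      (fun T => forall F, behavioral P F -> U (fun chi => T (upd chi p (F chi)))).
  move=> hY; apply: IH => T; rewrite pay_ext_AE.
  by split=> hp F /hp /hY.
by case: fl hU => hU; apply: h => // T; rewrite hU pay_dual_AE.
Qed.

Lemma functor_sat_dual P qs psi U U' : (forall T, U' (fun chi => ~ T chi) -> ~ U T) ->
  functor_sat P (dualq qs) (LNot psi) U' -> ~ functor_sat P qs psi U.
Proof.
elim: qs P U U' => [|[[] p] qs IH] P U U' hU /=; first exact: hU.
  apply: IH => T h [F [hF]]; apply: hU; exact: h.
by apply: IH => T [F [hF h]] h'; apply: (hU _ h); apply: h'.
Qed.

(** [U] evaluates the columns of [qs1], for which a winning strategy suffices by hypothesis. Each
    step moves a quantifier from [qs] to [qs1] and re-establishes the hypothesis by eliminating the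
    last column. *)
Lemma functor_sat_of_wintree x psi qs P qs1 (U : (asg -> Prop) -> Prop) : finite_ap P ->
  (forall T : word -> Prop, wintree qs1 x T -> U (fun chi => T (aval chi))) ->
  (forall T T' : asg -> Prop, (forall chi, asg_dom chi P -> T chi -> T' chi) -> U T -> U T') ->
  wintree (qs1 ++ qs) x (fun w => ltl_holds w 0 psi) -> functor_sat P qs psi U.
Proof.
elim: qs P qs1 U => [|[Q p] qs IH] P qs1 U fP hU mU.
  by rewrite cats0 => /hU.
rewrite -cat_rcons => hw; case: Q hw => hw; apply: (IH _ _ _ _ _ _ hw); try exact: finite_add.
- move=> T /wintree_ex[beta] /hU h; exists (fun chi => causal beta (aval chi)); split.
    move=> q Pq c1 c2 k d1 d2 [e1 e2].
    have e t : t <= k -> aval c1 t = aval c2 t.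
      move=> lt; apply: funext => q'; have [->|ne] := eqVneq q' q; first by apply: e2; apply/leP.
      have [Pq'|nP] := pselect (P q'); first by rewrite /aval e1 //; apply/eqP.
      have n1 : c1 q' = None by apply: contrapT => /d1.
      have n2 : c2 q' = None by apply: contrapT => /d2.
      by rewrite /aval n1 n2.
    rewrite /causal e //; congr beta.
    have : forall j, j <= k -> hist (aval c1) j = hist (aval c2) j.
      by elim=> //= j IHj lj; rewrite IHj ?e //; lia.
    exact.
  by apply: mU h => chi _; rewrite aval_upd.
- move=> T T' h [F [hF hT]]; exists F; split=> //.
  by apply: mU hT => chi dc; apply: h; apply: dom_upd.
- move=> T hT F hF.
  pose d : letter := fun=> false.
  pose wd (v : seq letter) t := nth d (rev v) t.
  pose asg_of w : asg := fun q => if `[< P q >] then Some (fun t => w t q) else None.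
  (* [F] is applied to the history extended by a default value; by [behavioral_causal] later values
     do not affect the present one of [F]. *)
  pose beta v a := F (asg_of (wd (a :: v))) (size v).
  apply: mU (hU _ (wintree_all beta hT)) => chi dc; rewrite aval_upd.
  suff -> : causal beta (aval chi) = F chi by [].
  apply: funext => k; rewrite /causal /beta size_hist.
  apply: (behavioral_causal fP hF) => //.
    by move=> q; rewrite /asg_of; case: asboolP.
  move=> q t /asboolP Pq tk; rewrite {1}/aval /asg_of Pq /wd.
  rewrite -[_ :: _]/(hist (aval chi) k.+1) rev_hist (nth_map 0) ?size_iota ?subn0 //.
  by rewrite nth_iota.
move=> T T' h hT F hF; apply: mU (hT F hF) => chi dc.
by apply: h; apply: dom_upd.
Qed.

Lemma functor_sat_single chi P qs psi : finite_ap P -> asg_dom chi P ->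
  wintree qs (aval chi) (fun w => ltl_holds w 0 psi) ->
  functor_sat P qs psi (fun T => T chi).
Proof.
move=> fP dc; apply: (@functor_sat_of_wintree _ _ _ _ [::]) => //.
  by move=> T /wintree_nil.
by move=> T T'; apply.
Qed.

Lemma gsat_single chi P phi : finite_ap P -> asg_dom chi P ->
  gsat P (single chi) FEA phi <->
  wintree (gprefix phi) (aval chi) (fun w => ltl_holds w 0 (gmatrix phi)).
Proof.
move=> fP dc; rewrite /gsat (@gsat_pre_functor _ _ _ _ _ (fun T => T chi)); last first.
  move=> T; split=> [h|[S [hS hT]]]; last by apply: hT; apply/hS.
  by exists (fun a => a = chi); split=> // a ->.
split; last exact: functor_sat_single.
(* By determinacy the universal player wins otherwise; then the dual prefix satisfies the negated
   matrix, against [h]. *)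
move=> h; have [//|hd] := wintree_determined (gprefix phi) (aval chi) (recog_ltl (gmatrix phi)).
have := functor_sat_single (psi := LNot (gmatrix phi)) fP dc hd.
by move/functor_sat_dual => /(_ _ (fun _ => id)).
Qed.

(** * Existential prefixes and Tarski semantics *)

Lemma rg_agree ps a a' (K : letter -> Prop) : (forall q, q \notin ps -> a' q = a q) ->
  K a' -> rg [seq (QuEx, p) | p <- ps] a K.
Proof.
elim: ps a => [|p ps IH] a h Ka /=.
  by suff -> : a = a' by []; apply: funext => q; rewrite h.
exists (a' p); apply: IH => // q hq; rewrite /upl; case: eqP => [->//|/eqP ne].
by apply: h; rewrite inE negb_or ne.
Qed.

(** Without an opponent a strategy may follow one word fixed in advance, so causality is no
    restriction. *)
Lemma wintree_exists ps x W : wintree [seq (QuEx, p) | p <- ps] x W <->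
  exists w, (forall t q, q \notin ps -> w t q = x t q) /\ W w.
Proof.
split.
  elim/last_ind: ps W => [|ps p IH] W; first by move=> /wintree_nil; exists x.
  rewrite map_rcons => /wintree_ex[beta /IH[w [hw Ww]]]; exists (colset w p (causal beta w)).
  split=> // t q; rewrite mem_rcons inE negb_or => /andP[/negbTE ne nq].
  by rewrite /colset /upl ne hw.
move=> [w [hw Ww]]; exists (fun v => v = hist w (size v)); split=> //.
  move=> v e; apply: (@rg_agree _ _ (w (size v))); first by move=> q; apply: hw.
  by rewrite /= -e.
move=> w' hw'; suff -> : w' = w by [].
by apply: funext => t; have := hw' t.+1; rewrite size_hist => -[].
Qed.

Fixpoint qsem (w : word) (phi : qptl) : Prop :=
  match phi with
  | QL psi => ltl_holds w 0 psi
  | QNot a => ~ qsem w a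
  | QAnd a b => qsem w a /\ qsem w b
  | QOr a b => qsem w a \/ qsem w b
  | QEx p a => exists f, qsem (colset w p f) a
  | QAll p a => forall f, qsem (colset w p f) a
  end.

Lemma qsat_qsem chi phi : qsat chi phi <-> qsem (aval chi) phi.
Proof.
elim: phi chi => [psi|a IHa|a IHa b IHb|a IHa b IHb|p a IHa|p a IHa] chi //=.
- by rewrite IHa.
- by rewrite IHa IHb.
- by rewrite IHa IHb.
- by split=> -[f h]; exists f; move: h; rewrite IHa aval_upd.
by split=> h f; have := h f; rewrite IHa aval_upd.
Qed.

Lemma wintree_one p x W : wintree [:: (QuEx, p)] x W <-> exists f, W (colset x p f).
Proof.
rewrite (wintree_exists [:: p]); split=> [[w [hw Ww]]|[f Wf]].
  exists (fun t => w t p); suff <- : w = colset x p (fun t => w t p) by [].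
  apply: funext => t; apply: funext => q; rewrite /colset /upl.
  by case: eqP => [->//|/eqP ne]; rewrite hw // inE.
exists (colset x p f); split=> // t q; rewrite inE => /negbTE ne.
by rewrite /colset /upl ne.
Qed.

(** A Tarski quantifier is, up to negation, the game of a prefix of length one. *)
Lemma recog_qsem phi : recog (fun w => qsem w phi).
Proof.
elim: phi => [psi|a IHa|a IHa b IHb|a IHa b IHb|p a IHa|p a IHa] /=.
- exact: recog_ltl.
- exact: recog_not.
- exact: recog_and.
- exact: recog_or.
- by apply: recog_ext (recog_wintree [:: (QuEx, p)] IHa) => w; rewrite wintree_one.
apply: recog_ext (recog_not (recog_wintree [:: (QuEx, p)] (recog_not IHa))) => w.
rewrite wintree_one; split=> [h f|h [f]]; last by apply.
by apply: contrapT => h'; apply: h; exists f.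
Qed.

(** * Büchi automata and the existential normal form in LTL *)

Lemma recog_buchi L : recog L ->
  exists (Q : finType) (init acc : Q -> Prop) (stp : Q -> letter -> Q -> Prop), forall w,
  L w <-> exists rho : nat -> Q, [/\ init (rho 0),
    forall k, stp (rho k) (w k) (rho k.+1) & infm (fun k => acc (rho k))].
Proof.
move=> [T [ty hr]]; have tyC := hr.1.
(* The type [s] of the first block and the common type [e] of the later ones determine membership.
   The automaton guesses a pair realized in [L] and checks a factorization of its input against
   it. *)
pose blocks w c s e := [/\ cut c, ty (seg w 0 (c 1)) = s &
  forall n, 0 < n -> ty (seg w (c n) (c n.+1)) = e].
have blocks_L w c w' c' s e : blocks w c s e -> blocks w' c' s e -> L w -> L w'.
  move=> [hc h0 hS] [hc' h0' hS']; apply: (hr.2 _ c _ c'); split=> // -[|n].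
    by rewrite hc.1 hc'.1 h0 h0'.
  by rewrite hS ?hS'.
pose Q := (T * T * bool * T * bool)%type.
(* A state holds the types of the first and of the later blocks, whether the first block is
   over, the type of the part of the current block read so far, and whether a block starts here. *)
pose init (q : Q) := let: (s, e, ph, t, fl) := q in
  [/\ ph = false, t = ty [::], fl = false & exists w c, L w /\ blocks w c s e].
pose acc (q : Q) := q.2 = true.
pose stp (q : Q) a (q' : Q) :=
  let: (s, e, ph, t, fl) := q in let: (s', e', ph', t', fl') := q' in
  [/\ s' = s, e' = e & exists u, ty u = t /\
    (if fl' then [/\ ph' = true, t' = ty [::] & ty (rcons u a) = if ph then e else s]
     else ph' = ph /\ t' = ty (rcons u a))].
exists Q, init, acc, stp => w; split.
  move=> Lw; have [_ [i [e [hs _ _]]]] := ex_stab tyC w.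
  have [c [hc _ _ hS]] := stab_cut tyC hs.
  have /choice[blk hblk] := fun t => cut_block t hc.
  pose s := ty (seg w 0 (c 1)).
  have blkE t n : c n <= t < c n.+1 -> blk t = n by move=> h; apply: (cut_block_inj hc (hblk t)).
  (* The flag marks the starts of all blocks but the first, so it is raised exactly when a block has
     been completed. *)
  exists (fun k => (s, e, 0 < blk k, ty (seg w (c (blk k)) k), (k == c (blk k)) && (0 < blk k))).
  split.
  - have -> : blk 0 = 0 by apply: blkE; have := hc.2 0; rewrite hc.1.
    by split; rewrite ?hc.1 ?segii // ?andbF //; exists w, c.
  - move=> k /=; split=> //; exists (seg w (c (blk k)) k); split=> //.
    have hk := hblk k; have [lt|ge] := ltnP k.+1 (c (blk k).+1).
      have -> : blk k.+1 = blk k by apply: blkE; lia.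
      by rewrite ifF; [rewrite seg_rcons //; lia|apply/negbTE/negP; lia].
    have ek : k.+1 = c (blk k).+1 by lia.
    have -> : blk k.+1 = (blk k).+1 by apply: blkE; have := hc.2 (blk k).+1; lia.
    rewrite -ek eqxx /= segii -seg_rcons; last lia.
    split=> //; rewrite ek; case: ifP => [|/negbT]; first by move/hS.
    by rewrite -eqn0Ngt => /eqP ->; rewrite hc.1.
  move=> N; exists (c N.+1); first by have := cut_ge N.+1 hc; lia.
  have -> : blk (c N.+1) = N.+1 by apply: blkE; rewrite leqnn hc.2.
  by rewrite /acc /= eqxx.
move=> [rho [h0 hS hA]].
case e0 : (rho 0) (h0) => [[[[s e] ph] t] fl] [_ _ _ [w' [c' [Lw' hb']]]].
pose sc k := (rho k).1.1.1; pose phs k := (rho k).1.1.2; pose cur k := (rho k).1.2.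
have stepE k : [/\ sc k.+1 = sc k & exists u, ty u = cur k /\
    (if (rho k.+1).2 then [/\ phs k.+1 = true, cur k.+1 = ty [::] &
       ty (rcons u (w k)) = if phs k then (sc k).2 else (sc k).1]
     else phs k.+1 = phs k /\ cur k.+1 = ty (rcons u (w k)))].
  have := hS k; rewrite /sc /phs /cur.
  case: (rho k) => [[[[s1 e1] ph1] t1] fl1]; case: (rho k.+1) => [[[[s2 e2] ph2] t2] fl2].
  by move=> [-> -> h].
have scE k : sc k = (s, e).
  by elim: k => [|k IH]; [rewrite /sc e0|have [-> _] := stepE k].
have [ph0 cur0] : phs 0 = false /\ cur 0 = ty [::].
  by move: h0; rewrite /phs /cur e0 => -[].
have /choice[nx hnx] : forall k, exists k', [/\ k < k', (rho k').2 &
    forall j, k < j < k' -> (rho j).2 = false].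
  move=> k; have ex : exists k', (k < k') && (rho k').2.
    by have [m hm am] := hA k.+1; exists m; rewrite hm.
  case: (ex_minnP ex) => k' /andP[h1 h2] hmin; exists k'; split=> // j hj.
  by apply/negP => fj; have : k' <= j by [apply: hmin; rewrite fj andbT; lia]; lia.
(* The cut points are the successive flagged positions of the accepting run. *)
pose fix c n := if n is n'.+1 then nx (c n') else 0.
have hc : cut c by split=> // n; case: (hnx (c n)).
have inv n : phs (c n) = (0 < n) -> cur (c n) = ty [::] -> forall j, c n <= j < c n.+1 ->
    phs j = (0 < n) /\ cur j = ty (seg w (c n) j).
  move=> p0 q0 j hj; have [le lt] : c n <= j /\ j < c n.+1 by lia.
  move: lt; rewrite -(subnKC le); elim: (j - c n) => [|k IH] lk.
    by rewrite addn0 segii.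
  rewrite addnS in lk *; have [p1 q1] := IH (ltnW lk).
  have [_ [u [eu]]] := stepE (c n + k).
  have [_ _ ->] := hnx (c n); last by rewrite -[nx _]/(c n.+1); lia.
  move=> [-> ->]; split=> //; rewrite seg_rcons ?leq_addr // -!cats1.
  by apply: tyC => //; rewrite eu.
have bnd n : [/\ phs (c n.+1) = true, cur (c n.+1) = ty [::] &
      phs (c n) = (0 < n) -> cur (c n) = ty [::] ->
      ty (seg w (c n) (c n.+1)) = if 0 < n then e else s].
  have lt := hc.2 n; have [k ek] : exists k, c n.+1 = k.+1 by exists (c n.+1).-1; lia.
  have [_ [u [eu]]] := stepE k; rewrite -ek.
  have [_ -> _] := hnx (c n) => -[h1 h2 h3]; split=> // p0 q0.
  have [p1 q1] := inv n p0 q0 k ltac:(lia).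
  rewrite ek seg_rcons; last lia.
  move: h3; rewrite p1 scE /= => <-; rewrite -!cats1; apply: tyC => //.
  by rewrite eu q1.
have start n : phs (c n) = (0 < n) /\ cur (c n) = ty [::].
  by case: n => [//|n]; have [-> ->] := bnd n.
apply: (blocks_L _ _ _ c _ _ hb') Lw'; split=> //.
  by have [_ _] := bnd 0; apply; case: (start 0).
by move=> n n0; have [_ _ ->] := bnd n; rewrite ?n0; case: (start n) => // ->.
Qed.

Definition restr (A : seq AP) (a : letter) : letter := fun q => (q \in A) && a q.

(* Shannon expansion over [A] of the property of the first letter given by [K]. *)
Fixpoint shannon (A : seq AP) (a : letter) (K : letter -> ltl) : ltl :=
  if A is q :: A' then
    LOr (LAnd (LAtom q) (shannon A' (upl a q true) K))
        (LAnd (LNot (LAtom q)) (shannon A' (upl a q false) K))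
  else K a.

Lemma shannonP A a K w i : ltl_holds w i (shannon A a K) <->
  ltl_holds w i (K (fun q => if q \in A then w i q else a q)).
Proof.
elim: A a => [|q A IH] a //=.
have E b : w i q = b -> (fun q' => if q' \in A then w i q' else upl a q b q') =
    (fun q' => if q' \in q :: A then w i q' else a q').
  move=> e; apply: funext => q'; rewrite inE /upl.
  by case: ifP => h; rewrite ?orbT // orbF; case: eqP => [->|].
rewrite !IH; case e : (w i q); rewrite (E _ e); first by intuition.
by intuition.
Qed.

Lemma shannon_atoms_sub (A A0 : seq AP) a K q : {subset A <= A0} ->
  (forall a' q', List.In q' (ltl_atoms (K a')) -> q' \in A0) ->
  List.In q (ltl_atoms (shannon A a K)) -> q \in A0.
Proof.
move=> + hK; elim: A a => [|p A IH] a hA /=; first exact: hK.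
have pA0 : p \in A0 by apply: hA; rewrite inE eqxx.
have {}IH b : List.In q (ltl_atoms (shannon A b K)) -> q \in A0.
  by apply: IH => x xA; apply: hA; rewrite inE xA orbT.
case=> [<- //|/List.in_app_iff[h|[<- //|h]]]; exact: IH h.
Qed.

Lemma shannon_atoms_sup (A : seq AP) a K q :
  q \in A -> List.In q (ltl_atoms (shannon A a K)).
Proof.
elim: A a => [|p A IH] a //=; rewrite inE => /orP[/eqP->|qA]; first by left.
by right; apply/List.in_app_iff; left; apply: IH.
Qed.

(** The expansion runs over all of [A], so the atoms are exactly [A] whatever [D] is; this controls
    the free propositions of the normal form. *)
Definition now A (D : letter -> Prop) : ltl :=
  shannon A (fun=> false) (fun a => if `[< D a >] then LTrue else LNot LTrue).

Definition now_next A (D : letter -> letter -> Prop) : ltl :=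
  shannon A (fun=> false) (fun a => LNext (now A (D a))).

Definition eventually psi := LUntil LTrue psi.
Definition always psi := LNot (eventually (LNot psi)).

Lemma nowP A D w i : ltl_holds w i (now A D) <-> D (restr A (w i)).
Proof.
rewrite shannonP; have -> : (fun q => if q \in A then w i q else false) = restr A (w i).
  by apply: funext => q; rewrite /restr; case: (q \in A).
by case: asboolP => h /=; tauto.
Qed.

Lemma now_nextP A D w i : ltl_holds w i (now_next A D) <->
  D (restr A (w i)) (restr A (w i.+1)).
Proof.
rewrite shannonP; have -> : (fun q => if q \in A then w i q else false) = restr A (w i).
  by apply: funext => q; rewrite /restr; case: (q \in A).
exact: nowP.
Qed.

Lemma eventuallyP psi w i : ltl_holds w i (eventually psi) <->
  exists2 j, i <= j & ltl_holds w j psi.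
Proof.
by split=> [[j [/leP ij [hj _]]]|[j /leP ij hj]]; exists j.
Qed.

Lemma alwaysP psi w : ltl_holds w 0 (always psi) <-> forall j, ltl_holds w j psi.
Proof.
rewrite /always -[ltl_holds w 0 (LNot _)]/(~ ltl_holds w 0 (eventually (LNot psi))) eventuallyP.
split=> [h j|h [j _ nj]]; last exact: nj (h j).
by apply: contrapT => hj; apply: h; exists j.
Qed.

Lemma now_atoms A D q : List.In q (ltl_atoms (now A D)) <-> q \in A.
Proof.
split; last exact: shannon_atoms_sup.
by apply: shannon_atoms_sub => // a q'; case: asboolP.
Qed.

Lemma now_next_atoms A D q : List.In q (ltl_atoms (now_next A D)) <-> q \in A.
Proof.
split; last exact: shannon_atoms_sup.
by apply: shannon_atoms_sub => // a q' /now_atoms.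
Qed.

Lemma recog_normal_form L (S : seq AP) : recog L -> exists (ps : seq AP) (psi : ltl),
  [/\ uniq ps, forall q, q \in ps -> q \notin S,
    forall q, List.In q (ltl_atoms psi) <-> q \in S \/ q \in ps &
    forall w, L (fun t => restr S (w t)) <->
      exists w', (forall t q, q \notin ps -> w' t q = w t q) /\ ltl_holds w' 0 psi].
Proof.
move=> /recog_buchi[Q [init [acc [stp hL]]]].
(* Each state of the automaton gets a proposition numbered above all of [S], hence fresh. *)
pose base := (\max_(q <- S) q).+1.
pose ps := [seq base + val (enum_rank x) | x <- enum Q].
have psP (x : Q) : base + val (enum_rank x) \in ps by apply/mapP; exists x; rewrite ?mem_enum.
have psS q : q \in ps -> q \notin S.
  move=> /mapP[x _ ->]; apply/negP => h.
  have : base + val (enum_rank x) <= \max_(q <- S) q.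
    exact: (@leq_bigmax_seq _ S xpredT id).
  by rewrite /base; lia.
pose A := S ++ ps.
(* Several state propositions may be true in a letter; [pick] still makes the letter stand for one
   state. *)
pose dec (a : letter) := [pick x : Q | a (base + val (enum_rank x))].
have decA a : dec (restr A a) = dec a.
  by apply: eq_pick => x; rewrite /restr mem_cat psP orbT.
have resA a : restr S (restr A a) = restr S a.
  by apply: funext => q; rewrite /restr mem_cat; case: (q \in S).
pose D0 a := exists2 x, dec a = Some x & init x.
pose D2 a b := exists x y, [/\ dec a = Some x, dec b = Some y & stp x (restr S a) y].
pose Da a := exists2 x, dec a = Some x & acc x.
exists ps, (LAnd (now A D0) (LAnd (always (now_next A D2)) (always (eventually (now A Da))))).
split=> //.
- rewrite map_inj_uniq ?enum_uniq // => x y /addnI /val_inj; exact: enum_rank_inj.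
- move=> q; have E : q \in A <-> q \in S \/ q \in ps by rewrite mem_cat; split=> /orP.
  by rewrite /= !List.in_app_iff !now_atoms now_next_atoms E; tauto.
have andE w a b : ltl_holds w 0 (LAnd a b) = (ltl_holds w 0 a /\ ltl_holds w 0 b) by [].
move=> w; rewrite hL; split.
  move=> [rho [h0 hS hA]].
  pose w' t q := if q \in ps then q == base + val (enum_rank (rho t)) else w t q.
  have decw t : dec (w' t) = Some (rho t).
    rewrite /dec; case: pickP => [x|/(_ (rho t))]; rewrite /w' psP ?eqxx //.
    by move=> /eqP /addnI /val_inj /enum_rank_inj ->.
  have resw t : restr S (w' t) = restr S (w t).
    apply: funext => q; rewrite /restr /w'; case: ifP => // /psS /negbTE -> //.
  exists w'; split; first by move=> t q /negbTE; rewrite /w' => ->.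
  split; first by apply/nowP; exists (rho 0); rewrite ?decA.
  rewrite andE !alwaysP; split=> k; first by apply/now_nextP; exists (rho k), (rho k.+1); rewrite !decA resA resw.
  have [m km am] := hA k; apply/eventuallyP; exists m => //.
  by apply/nowP; exists (rho m); rewrite ?decA.
move=> [w' [hw]]; rewrite !andE !alwaysP => -[/nowP h0 [hS hA]].
have /choice[rho hrho] : forall k, exists x, dec (w' k) = Some x.
  by move=> k; have /now_nextP[x [y [+ _ _]]] := hS k; rewrite decA; exists x.
have resw t : restr S (w' t) = restr S (w t).
  apply: funext => q; rewrite /restr; case qS : (q \in S) => //=; apply: hw.
  by apply/negP => /psS; rewrite qS.
exists rho; split.
- by move: h0 => [x]; rewrite decA hrho => -[->].
- by move=> k; have /now_nextP[x [y []]] := hS k; rewrite !decA !hrho resA resw => -[->] [->].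
move=> N; have /eventuallyP[m Nm /nowP[x]] := hA N; rewrite decA hrho => -[<-] ax.
by exists m.
Qed.

(** * Free propositions and the two translations *)

Lemma restr_dom (S : seq AP) (P : apset) chi : (forall q, P q <-> q \in S) ->
  asg_dom chi P -> (fun t => restr S (aval chi t)) = aval chi.
Proof.
move=> hS dc; apply: funext => t; apply: funext => q; rewrite /restr.
case qS : (q \in S) => //=; rewrite /aval; case e : (chi q) => [f|] //.
by move: qS => /negP; case; apply/hS/dc; rewrite e.
Qed.

Lemma In_mem (q : AP) s : List.In q s <-> q \in s.
Proof.
elim: s => //= p s IH; rewrite inE IH; split=> [[->|->]|/orP[/eqP ->|->]]; by [rewrite ?eqxx ?orbT|left|right].
Qed.

Lemma NoDup_uniq (s : seq AP) : uniq s -> List.NoDup s.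
Proof.
by elim: s => [|p s IH] /=; [constructor|move=> /andP[/negP np /IH us]; constructor=> // /In_mem].
Qed.

Lemma qfree_finite phi : exists S : seq AP, forall q, qfree phi q <-> q \in S.
Proof.
have union (P P' : AP -> Prop) : (exists S : seq AP, forall q, P q <-> q \in S) ->
    (exists S : seq AP, forall q, P' q <-> q \in S) ->
    exists S : seq AP, forall q, (P q \/ P' q) <-> q \in S.
  by move=> [S h] [S' h']; exists (S ++ S') => q; rewrite h h' mem_cat; split=> /orP.
have remove (P : AP -> Prop) p : (exists S : seq AP, forall q, P q <-> q \in S) ->
    exists S : seq AP, forall q, (P q /\ q <> p) <-> q \in S.
  move=> [S h]; exists [seq q <- S | q != p] => q; rewrite h mem_filter.
  by split=> [[-> /eqP ->]|/andP[/eqP]].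
elim: phi => [psi|a IHa|a IHa b IHb|a IHa b IHb|p a IHa|p a IHa] //=; auto.
by exists (ltl_atoms psi) => q; apply: In_mem.
Qed.

Definition exists_qptl ps psi := foldr QEx (QL psi) ps.

Lemma qfree_exists ps psi q : qfree (exists_qptl ps psi) q <->
  List.In q (ltl_atoms psi) /\ q \notin ps.
Proof.
elim: ps => [|p ps IH] /=; first by split=> [|[]].
rewrite IH inE negb_or; split=> [[[h1 h2] /eqP h3]|[h1 /andP[/eqP h2 h3]]] //.
by rewrite h2 h3.
Qed.

Lemma qsem_exists ps psi w : qsem w (exists_qptl ps psi) <->
  exists w', (forall t q, q \notin ps -> w' t q = w t q) /\ ltl_holds w' 0 psi.
Proof.
elim: ps w => [|p ps IH] w /=.
  split=> [h|[w' [h]]]; first by exists w.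
  by have -> : w' = w by apply: funext => t; apply: funext => q; apply: h.
split=> [[f /IH[w' [hw h]]]|[w' [hw h]]].
  exists w'; split=> // t q; rewrite inE negb_or => /andP[/negbTE ne nq].
  by rewrite hw // /colset /upl ne.
exists (fun t => w' t p); apply/IH; exists w'; split=> // t q nq.
rewrite /colset /upl; case: eqP => [->//|/eqP ne].
by apply: hw; rewrite inE negb_or ne.
Qed.

Theorem mainTheorem20 :
  (forall phi : qptl, exists phi' : gfg,
      gfg_wf phi' /\
      (forall q, gfree phi' q <-> qfree phi q) /\
      (forall chi : asg, asg_dom chi (qfree phi) ->
         (qsat chi phi <-> gsat (qfree phi) (single chi) FEA phi')))
  /\
  (forall phi' : gfg, gfg_wf phi' -> exists phi : qptl,
      (forall q, qfree phi q <-> gfree phi' q) /\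
      (forall chi : asg, asg_dom chi (gfree phi') ->
         (qsat chi phi <-> gsat (gfree phi') (single chi) FEA phi'))).
Proof.
split=> [phi|phi' wf].
  have [S hS] := qfree_finite phi.
  have [ps [psi [ups psS hat hL]]] := recog_normal_form S (recog_qsem phi).
  have snds : List.map snd [seq (QuEx, p) | p <- ps] = ps.
    by elim: (ps) => //= p s ->.
  exists (mkGfg [seq (QuEx, p) | p <- ps] psi); split; [|split].
  - by rewrite /gfg_wf /= snds; apply: NoDup_uniq.
  - move=> q; rewrite /gfree /= snds hat hS In_mem.
    by split=> [[[//|h] //]|qS]; split; [left|move=> /psS; rewrite qS].
  move=> chi dc; rewrite gsat_single //; last by exists S => q /hS.
  by rewrite wintree_exists -hL (restr_dom hS dc) qsat_qsem.
pose S := [seq q <- ltl_atoms (gmatrix phi') | q \notin List.map snd (gprefix phi')].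
have hS q : gfree phi' q <-> q \in S.
  by rewrite /gfree !In_mem mem_filter; split=> [[-> /negP ->]|/andP[/negP]].
have rec := recog_wintree (gprefix phi') (recog_ltl (gmatrix phi')).
have [ps [psi [ups psS hat hL]]] := recog_normal_form S rec.
exists (exists_qptl ps psi); split.
  move=> q; rewrite qfree_exists hat hS; split=> [[[//|h]]|qS]; first by rewrite h.
  by split; [left|apply/negP => /psS; rewrite qS].
move=> chi dc; rewrite gsat_single //; last by exists S => q /hS.
by rewrite qsat_qsem qsem_exists -hL (restr_dom hS dc).
Qed.
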